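(* For every integer $n\ge 1$ and every ordinal $\gamma$, the inverse system $\mathbf d_n\mathbf P_n(\gamma)$ is free if and only if there exists an $n$-dimensional tail-acyclic simplicial complex on $\gamma$.
   Context: For a set $A$ of ordinals and $n\ge 0$, $P_n(A)$ is the free abelian group with generators $\langle\vec\alpha\rangle$, $\vec\alpha\in[A]^{n+1}$ (strictly increasing tuples). For $n\ge1$, $d_n:P_n(A)\to P_{n-1}(A)$ is $\langle\vec\alpha\rangle\mapsto\sum_{i=0}^n(-1)^i\langle\vec\alpha^i\rangle$, $\vec\alpha^i$ being $\vec\alpha$ with its $i$-th coordinate (from $0$) removed. An inverse system indexed by an ordinal $\gamma$ is $\mathbf X=(X_\alpha,x_{\alpha\beta},\gamma)$ with groups $X_\alpha$ and compatible homomorphisms $x_{\alpha\beta}:X_\beta\to X_\alpha$ for $\alpha\le\beta<\gamma$. $\mathbf d_n\mathbf P_n(\gamma)$ is the system whose term at $\alpha<\gamma$ is the subgroup $d_n(P_n([\alpha,\gamma)))$ of $P_{n-1}([\alpha,\gamma))$, with inclusion bonding maps. A system $\mathbf X$ is free if there is $\mathcal B\subseteq\bigcup_\alpha X_\alpha$ such that every $x\in X_\alpha$ has a unique decomposition $x=\sum_{i<k}a_i x_{\alpha\beta_i}(b_i)$ with $\alpha\le\beta_i$, distinct $b_i\in X_{\beta_i}\cap\mathcal B$ and nonzero integers $a_i$. A simplicial complex on $\gamma$ is a family of nonempty finite subsets of $\gamma$ closed under nonempty subsets; $B^k$ denotes its set of $(k+1)$-element members ($k$-faces), its dimension is $\sup\{k:B^k\ne\varnothing\}$.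 Reduced simplicial homology $\tilde{\mathrm H}^\Delta_k$ is computed from the chain groups $C_k(B)=\bigoplus_{B^k}\mathbb Z$ with boundary $\partial_k\langle\vec\alpha\rangle=\sum_i(-1)^i\langle\vec\alpha^i\rangle$ (faces written as increasing tuples), $C_{-1}=\mathbb Z$, $\partial_0\langle\alpha\rangle=1$. $B|_X$ is the subcomplex of faces contained in $X$. An $n$-dimensional complex $G$ on $\gamma$ is tail-acyclic if $G^{n-1}=[\gamma]^n$ and $\tilde{\mathrm H}^\Delta_k(G|_{[\alpha,\gamma)})=0$ for all $\alpha<\gamma$ and $k\ge0$.
   Formalization: When γ has at most n elements no n-face exists although the zero system is free, so the equivalence fails as stated; there ''n-dimensional'' is read as ''of dimension at most n''. For all γ with at least n+1 elements the dimension is exactly n. *)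

(* Defs.v *)
From HB Require Import structures.
From mathcomp Require Import all_boot all_order all_algebra.
From mathcomp Require Import finmap boolp.
From mathcomp Require Import freeg.

Set Implicit Arguments.
Unset Strict Implicit.
Unset Printing Implicit Defensive.

Import Order.TTheory GRing.Theory.

Local Open Scope ring_scope.
Local Open Scope order_scope.
Local Open Scope fset_scope.

(* Ordinals are represented by well-ordered types: an ordinal [gamma] is an
   [orderType] whose strict order is well-founded, and the ordinals
   [alpha < gamma] are its elements. *)
Definition well_ordered (disp : Order.disp_t) (gamma : orderType disp) : Prop :=
  well_founded (fun x y : gamma => x < y).

Section Simplices.
Context (disp : Order.disp_t) (gamma : orderType disp).

(* m counts vertices: the elements of [simplex m] have dimension m - 1. *)
Definition simplex (m : nat) : Type := {t : m.-tuple gamma | sorted <%O t}.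

HB.instance Definition _ m := SubChoice.on (simplex m).

Definition vertices m (s : simplex m) : {fset gamma} :=
  [fset x in tval (val s)].

Fact del_subproof m (s : simplex m.+1) (i : 'I_m.+1) :
  sorted <%O [tuple tnth (val s) (fintype.lift i j) | j < m].
Proof.
have s_lt (a b : 'I_m.+1) : (a < b)%N -> tnth (val s) a < tnth (val s) b.
  move=> ab; have x0 : gamma by exact: (tnth (val s) ord0).
  rewrite !(tnth_nth x0); apply: (sorted_ltn_nth lt_trans) => //.
  - exact: (valP s).
  - by rewrite inE size_tuple ltn_ord.
  - by rewrite inE size_tuple ltn_ord.
rewrite /= sorted_pairwise; last exact: lt_trans.
rewrite pairwise_map -sorted_pairwise; last first.
  by move=> b a c /=; apply: lt_trans.
have : sorted ltn [seq val j | j <- enum 'I_m].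
  by rewrite val_enum_ord iota_ltn_sorted.
rewrite sorted_map; apply: sub_sorted => a b /= ab.
apply: s_lt; rewrite /= /bump.
case: (leqP i a) (leqP i b) => ia [] ib; rewrite ?add0n ?add1n //.
  by move: (leq_trans ia (ltnW ab)); rewrite leqNgt ib.
exact: ltnW.
Qed.

Definition del m (s : simplex m.+1) (i : 'I_m.+1) : simplex m :=
  exist (fun t : m.-tuple gamma => sorted <%O t) _ (del_subproof s i).

End Simplices.

(* [chain n.+1] is P_n(gamma), and [bd n] below is d_n : P_n -> P_(n-1).
   [chain 0] is free on the empty tuple, i.e. the group Z in degree -1, and
   [bd 0] sends every vertex to its generator, i.e. is the augmentation. *)
Notation chain gamma m := {freeg (simplex gamma m) / int}.

Section Chains.
Context (disp : Order.disp_t) (gamma : orderType disp).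

Definition bd m : chain gamma m.+1 -> chain gamma m :=
  fglift (fun s : simplex gamma m.+1 =>
    \sum_(i < m.+1) << (-1) ^+ i *g del s i >> : chain gamma m).

Fact bd_is_additive m : zmod_morphism (@bd m).
Proof. exact: lift_is_additive. Qed.

HB.instance Definition _ m :=
  GRing.isZmodMorphism.Build (chain gamma m.+1) (chain gamma m) (@bd m)
    (@bd_is_additive m).

(* For A a subset of gamma, P_n(A) is identified with the subgroup of P_n(gamma)
   of the chains supported on tuples of elements of A. *)
Definition chain_on m (A : {pred gamma}) (c : chain gamma m) : Prop :=
  forall s, s \in dom c -> {subset tval (val s) <= A}.

Definition tail (a : gamma) : {pred gamma} := [pred x | a <= x].

End Chains.

Record inverse_system (disp : Order.disp_t) (gamma : orderType disp) :=
  InverseSystem {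
    term : gamma -> zmodType;
    bond : forall a b : gamma, a <= b -> {additive term b -> term a};
    bond_id : forall (a : gamma) (h : a <= a) (x : term a), bond h x = x;
    bond_comp : forall (a b c : gamma) (hab : a <= b) (hbc : b <= c)
      (hac : a <= c) (x : term c), bond hab (bond hbc x) = bond hac x
  }.

Arguments term {disp gamma} X a : rename.
Arguments bond {disp gamma} X {a b} h : rename.

Section Free.
Context (disp : Order.disp_t) (gamma : orderType disp).
Context (X : inverse_system gamma).

Definition above (a : gamma) : Type :=
  {p : {b : gamma & term X b} | a <= tag p}.

HB.instance Definition _ a := SubChoice.on (above a).

Definition bond_above (a : gamma) (p : above a) : term X a :=
  bond X (valP p) (tagged (val p)).

(* A subset of the (disjoint) union of the X_b is a family [B] of predicates.
   An element [f] of {freeg K / int} is a finite formal sum of distinct keys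
   with nonzero coefficients, up to reordering; its keys are listed by [dom]. *)
Definition decomposition (B : forall b, term X b -> Prop) (a : gamma)
    (x : term X a) (f : {freeg (above a) / int}) : Prop :=
  (forall p, p \in dom f -> B (tag (val p)) (tagged (val p))) /\
  x = \sum_(p <- dom f) bond_above p *~ coeff p f.

Definition free_system : Prop :=
  exists B : forall b, term X b -> Prop,
    forall (a : gamma) (x : term X a), exists! f, decomposition B x f.

End Free.

Section BoundarySystem.
Context (disp : Order.disp_t) (gamma : orderType disp).

Definition dP_pred (n : nat) (a : gamma) : {pred chain gamma n} :=
  fun z => `[< exists2 c : chain gamma n.+1, chain_on (tail a) c & z = bd c >].

Arguments dP_pred : clear implicits.

Fact dP_pred_zmod n a : zmod_closed (dP_pred n a).
Proof.
split=> [|_ _ /asboolP[c1 c1P ->] /asboolP[c2 c2P ->]]; apply/asboolP.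
  exists 0; last by rewrite raddf0.
  by move=> s; rewrite dom0.
exists (c1 - c2); last by rewrite raddfB.
by move=> s /domB; rewrite mem_cat => /orP[/c1P|/c2P].
Qed.

Fact dP_pred_le n (a b : gamma) (z : chain gamma n) :
  a <= b -> z \in dP_pred n b -> z \in dP_pred n a.
Proof.
move=> ab /asboolP[c cP ->]; apply/asboolP; exists c => // s /cP sP x /sP.
exact: le_trans.
Qed.

HB.instance Definition _ n a :=
  GRing.isZmodClosed.Build (chain gamma n) (dP_pred n a) (@dP_pred_zmod n a).

Definition dP_term (n : nat) (a : gamma) : Type :=
  {z : chain gamma n | z \in dP_pred n a}.

HB.instance Definition _ n a := SubChoice.on (dP_term n a).
HB.instance Definition _ n a := [SubChoice_isSubZmodule of dP_term n a by <:].

Definition dP_incl (n : nat) (a b : gamma) (h : a <= b) (x : dP_term n b) :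
    dP_term n a :=
  exist _ (val x) (dP_pred_le h (valP x)).

Fact dP_incl_is_additive n (a b : gamma) (h : a <= b) :
  zmod_morphism (@dP_incl n a b h).
Proof. by move=> x y; apply: val_inj. Qed.

HB.instance Definition _ n a b h :=
  GRing.isZmodMorphism.Build (dP_term n b) (dP_term n a) (@dP_incl n a b h)
    (@dP_incl_is_additive n a b h).

Fact dP_incl_id n (a : gamma) (h : a <= a) (x : dP_term n a) :
  dP_incl h x = x.
Proof. exact: val_inj. Qed.

Fact dP_incl_comp n (a b c : gamma) (hab : a <= b) (hbc : b <= c)
  (hac : a <= c) (x : dP_term n c) :
  dP_incl hab (dP_incl hbc x) = dP_incl hac x.
Proof. exact: val_inj. Qed.

Definition dP (n : nat) : inverse_system gamma :=
  @InverseSystem disp gamma (fun a => dP_term n a : zmodType)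
    (fun a b h => @dP_incl n a b h : {additive dP_term n b -> dP_term n a})
    (@dP_incl_id n) (@dP_incl_comp n).

End BoundarySystem.

Section Complexes.
Context (disp : Order.disp_t) (gamma : orderType disp).
Implicit Type B : {fset gamma} -> Prop.

Definition simplicial_complex B : Prop :=
  (forall s, B s -> s != fset0) /\
  (forall s t, B s -> t `<=` s -> t != fset0 -> B t).

Definition face B (k : nat) (s : {fset gamma}) : Prop :=
  B s /\ #|` s| = k.+1.

(* sup {k : B^k nonempty} = n. A set of at most n ordinals carries no n-face at
   all, while the system of boundaries is then zero, hence free; on such a
   gamma, and only there, n-dimensional is read as the upper bound alone. *)
Definition n_dimensional B (n : nat) : Prop :=
  (forall k s, face B k s -> (k <= n)%N) /\
  ((exists s : {fset gamma}, #|` s| = n.+1) -> exists s, face B n s).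

Definition restrict B (A : {pred gamma}) : {fset gamma} -> Prop :=
  fun s => B s /\ {subset s <= A}.

(* C_k(B), as a subgroup of C_k of the full simplex on gamma; only degrees
   k >= 0 occur, so the degree -1 part is always all of [chain gamma 0]. *)
Definition chain_in B k (c : chain gamma k.+1) : Prop :=
  forall s, s \in dom c -> B (vertices s).

Definition reduced_homology_vanishes B (k : nat) : Prop :=
  forall z : chain gamma k.+1, chain_in B z -> bd z = 0 ->
    exists2 c : chain gamma k.+2, chain_in B c & bd c = z.

Definition tail_acyclic B (n : nat) : Prop :=
  (forall s, face B n.-1 s <-> #|` s| = n) /\
  forall (a : gamma) (k : nat),
    reduced_homology_vanishes (restrict B (tail a)) k.

End Complexes.

(* Main.v *)
From HB Require Import structures.
From mathcomp Require Import all_boot all_order all_algebra.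
From mathcomp Require Import finmap boolp freeg.
Require Import Defs.

Set Implicit Arguments.
Unset Strict Implicit.
Unset Printing Implicit Defensive.

Import Order.TTheory GRing.Theory.

Local Open Scope ring_scope.
Local Open Scope order_scope.

(** The system is free iff the boundary map splits compatibly with all tails iff
    some tail-acyclic complex exists. A tail-acyclic complex [G] gives the basis
    of the boundaries of its n-faces, each placed at its least vertex.
    Conversely, a basis gives a map [sigma \o d] for a section [sigma] of [d]
    that preserves tails, and the n-faces are built by induction on [n] for all
    subsets [A] of gamma carrying such a splitting.

    To get an acyclic set of (n+1)-faces on [A], it is enough to have a cofinal
    [E] in [A] and, for each [d] in [E], an acyclic set of n-faces on the part of
    [E] below [d]: insert the vertices of [E] one at a time, coning each [d] over
    that set, and then the other vertices [v] of [A], coning each [v] over all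
    the n-faces that contain a chosen element of [E] above [v]. If [A] has
    countable cofinality, take [E] of order type at most omega. Otherwise pass to
    a cofinal [D] of regular order type, on which the splitting survives, and let
    [E] consist of the [d] such that the chains of [D] below [d] are closed under
    the splitting: below such a [d], a splitting in degree n+1 evaluated on cones
    with apex [d] yields a splitting in degree n. *)

(** * Supports in free abelian groups *)

Section Supports.
Context (K : choiceType).
Implicit Types (c : {freeg K / int}) (P : K -> Prop).

HB.instance Definition _ (M : lmodType int) (f : K -> M) :=
  GRing.isZmodMorphism.Build {freeg K / int} M (fglift f) (lift_is_additive f).

Definition supported P c : Prop := forall s, s \in dom c -> P s.

Lemma fgliftU (M : lmodType int) (f : K -> M) s : fglift f << s >> = f s.
Proof. by rewrite liftU scale1r. Qed.

Lemma supported_ind P (Q : {freeg K / int} -> Prop) :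
  Q 0 -> (forall a b, Q a -> Q b -> Q (a - b)) ->
  (forall s, P s -> Q << s >>) -> forall c, supported P c -> Q c.
Proof.
move=> Q0 QB QU c Pc.
have QN a : Q a -> Q (- a) by move=> Qa; rewrite -sub0r; apply: QB.
have QD a b : Q a -> Q b -> Q (a + b).
  by move=> Qa Qb; rewrite -[b]opprK; apply: QB => //; apply: QN.
have QMn a k : Q a -> Q (a *+ k).
  by move=> Qa; elim: k => [|k IH]; rewrite ?mulr0n // mulrS; apply: QD.
rewrite -[c]freeg_sumE big_seq; apply: big_ind => // s /Pc /QU Qs.
rewrite -[coeff s c]intz -freegU_mulz; case: (coeff s c) => k.
  by rewrite -pmulrn; apply: QMn.
by rewrite NegzE -nmulrn; apply/QN/QMn.
Qed.

Lemma supported0 P : supported P 0.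
Proof. by move=> s; rewrite dom0. Qed.

Lemma supportedN P c : supported P c -> supported P (- c).
Proof. by move=> Pc s; rewrite domN => /Pc. Qed.

Lemma supportedD P c1 c2 :
  supported P c1 -> supported P c2 -> supported P (c1 + c2).
Proof.
by move=> P1 P2 s /domD_subset; rewrite mem_cat => /orP[/P1|/P2].
Qed.

Lemma supportedB P c1 c2 :
  supported P c1 -> supported P c2 -> supported P (c1 - c2).
Proof. by move=> P1 P2; apply: supportedD => //; apply: supportedN. Qed.

Lemma supportedU P s : P s -> supported P << s >>.
Proof. by move=> Ps t; rewrite domU1 inE => /eqP->. Qed.

Lemma supportedW P P' c :
  (forall s, P s -> P' s) -> supported P c -> supported P' c.
Proof. by move=> PP' Pc s /Pc /PP'. Qed.

Lemma supported_eq0 P c : (forall s, ~ P s) -> supported P c -> c = 0.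
Proof.
move=> nP Pc; apply/eqP; rewrite -dom_eq0; case E: (dom c) => [//|s u].
by case: (nP s); apply: Pc; rewrite E mem_head.
Qed.

Lemma supported_neq0 c : c <> 0 -> exists s, s \in dom c.
Proof.
move=> c0; case E: (dom c) => [|s u]; last by exists s; rewrite mem_head.
by case: c0; apply/eqP; rewrite -dom_eq0 E.
Qed.

End Supports.

Lemma supported_lift (K L : choiceType) (P : K -> Prop) (Q : L -> Prop)
    (f : K -> {freeg L / int}) c :
  (forall s, P s -> supported Q (f s)) -> supported P c ->
  supported Q (fglift f c).
Proof.
move=> fP; move: c.
apply: (@supported_ind _ P (fun c => supported Q (fglift f c)))
  => [|a b Ha Hb|s /fP].
- by rewrite raddf0; apply: supported0.
- by rewrite raddfB; apply: supportedB.
- by rewrite fgliftU.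
Qed.

(** * Boundary, cone and link operators on chains of sequences *)

Section Sequences.
Context (disp : Order.disp_t) (gamma : orderType disp).
Local Notation C := {freeg (seq gamma) / int}.
Implicit Types (s t u : seq gamma) (c : C) (v x y a : gamma).
Implicit Types (A B D : gamma -> Prop).

Definition prepend x : C -> C := fglift (fun t => << x :: t >> : C).

HB.instance Definition _ x := GRing.isZmodMorphism.Build C C (prepend x)
  (lift_is_additive _).

Lemma prependU x t : prepend x << t >> = << x :: t >>.
Proof. exact: fgliftU. Qed.

(** Recursion on the first vertex replaces the alternating sum, which [bd_seqE] recovers. The
    complex is augmented: the empty sequence spans degree -1. *)
Fixpoint bd_seq s : C :=
  if s is x :: t then << t >> - prepend x (bd_seq t) else 0.

Definition dd : C -> C := fglift bd_seq.

HB.instance Definition _ := GRing.isZmodMorphism.Build C C dd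
  (lift_is_additive _).

Lemma ddU s : dd << s >> = bd_seq s.
Proof. exact: fgliftU. Qed.

Lemma dd_prepend x c : dd (prepend x c) = c - prepend x (dd c).
Proof.
apply: (@supported_ind _ (fun=> True)
  (fun c => dd (prepend x c) = c - prepend x (dd c))) => // [|a b Ha Hb|s _].
- by rewrite !raddf0 ?addr0.
- by rewrite !raddfB /= Ha Hb addrACA -opprD.
- by rewrite prependU !ddU.
Qed.

Lemma dd_dd c : dd (dd c) = 0.
Proof.
apply: (@supported_ind _ (fun=> True) (fun c => dd (dd c) = 0)) => //.
- by rewrite !raddf0.
- by move=> a b Ha Hb; rewrite !raddfB /= Ha Hb subr0.
move=> s _; rewrite ddU; elim: s => [|x t IH] /=; first by rewrite raddf0.
by rewrite raddfB /= ddU dd_prepend IH raddf0 subr0 subrr.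
Qed.

Fixpoint cone_seq v s : C :=
  if s is x :: t then
    if v < x then << v :: s >> else
    if v == x then 0 else - prepend x (cone_seq v t)
  else << [:: v] >>.

(* The signed insertion of a vertex, which need not be the least one. *)
Definition cone v : C -> C := fglift (cone_seq v).

HB.instance Definition _ v := GRing.isZmodMorphism.Build C C (cone v)
  (lift_is_additive _).

Lemma coneU v s : cone v << s >> = cone_seq v s.
Proof. exact: fgliftU. Qed.

Lemma cone_prepend_lt v x c : v < x ->
  cone v (prepend x c) = prepend v (prepend x c).
Proof.
move=> vx; apply: (@supported_ind _ (fun=> True)
  (fun c => cone v (prepend x c) = prepend v (prepend x c))) => //.
- by rewrite !raddf0.
- by move=> a b Ha Hb; rewrite !raddfB /= Ha Hb.
- by move=> s _; rewrite !prependU coneU /= vx.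
Qed.

Lemma cone_prepend_eq v c : cone v (prepend v c) = 0.
Proof.
apply: (@supported_ind _ (fun=> True)
  (fun c => cone v (prepend v c) = 0)) => //.
- by rewrite !raddf0.
- by move=> a b Ha Hb; rewrite !raddfB /= Ha Hb subr0.
- by move=> s _; rewrite !prependU coneU /= ltxx eqxx.
Qed.

Lemma cone_prepend_gt v x c : x < v ->
  cone v (prepend x c) = - prepend x (cone v c).
Proof.
move=> xv; apply: (@supported_ind _ (fun=> True)
  (fun c => cone v (prepend x c) = - prepend x (cone v c))) => //.
- by rewrite !raddf0 ?oppr0.
- by move=> a b Ha Hb; rewrite !raddfB /= Ha Hb.
- by move=> s _; rewrite !prependU !coneU /= ltNge (ltW xv) gt_eqF.
Qed.

Lemma cone_seq_path v s : path <%O v s -> cone_seq v s = << v :: s >>.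
Proof. by case: s => //= x s /andP[-> _]. Qed.

(** Coning is a contracting homotopy of the augmented full simplex, wherever [v] sits in the order.
    If [v] lies in [s], the first term vanishes and in the second only the face opposite [v]
    survives. *)
Lemma cone_homotopy_seq v s : sorted <%O s ->
  dd (cone v << s >>) + cone v (dd << s >>) = << s >>.
Proof.
elim: s => [|x t IH] /= st.
  by rewrite coneU /= !ddU /= !raddf0 !addr0.
rewrite coneU ddU /=.
case: ltgtP => [vx|xv|xv].
- have vt : path <%O v t by apply: path_le st => //; apply: lt_trans.
  rewrite ddU /= [cone v _]raddfB /= coneU cone_seq_path // cone_prepend_lt //.
  by rewrite raddfB /= prependU; rewrite addrNK.
- rewrite !raddfN !raddfB /= dd_prepend coneU cone_prepend_gt //.
  move/path_sorted/IH: st; rewrite coneU => E.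
  rewrite opprB opprK addrA addrNK -raddfD /= ddU in E *.
  by rewrite E prependU.
- rewrite -xv in st *; rewrite raddf0 add0r raddfB /= coneU cone_seq_path //.
  by rewrite cone_prepend_eq subr0.
Qed.

(** Algebraic link of [v]: it undoes [cone v] with its sign, so that a chain is the cone over its
    link plus a chain avoiding [v]. *)
Fixpoint uncone_seq v s : C :=
  if s is x :: t then
    if x == v then << t >> else - prepend x (uncone_seq v t)
  else 0.

Definition uncone v : C -> C := fglift (uncone_seq v).

HB.instance Definition _ v := GRing.isZmodMorphism.Build C C (uncone v)
  (lift_is_additive _).

Lemma unconeU v s : uncone v << s >> = uncone_seq v s.
Proof. exact: fgliftU. Qed.

Lemma uncone_prepend v x c : x != v ->
  uncone v (prepend x c) = - prepend x (uncone v c).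
Proof.
move=> xv; apply: (@supported_ind _ (fun=> True)
  (fun c => uncone v (prepend x c) = - prepend x (uncone v c))) => //.
- by rewrite !raddf0 ?oppr0.
- by move=> a b Ha Hb; rewrite !raddfB /= Ha Hb.
- by move=> s _; rewrite !prependU !unconeU /= (negbTE xv).
Qed.

Lemma cone_uncone_seq v s : sorted <%O s -> v \in s ->
  cone v (uncone v << s >>) = << s >>.
Proof.
elim: s => [//|x t IH] /= st; rewrite unconeU inE /= [v == x]eq_sym.
case: eqP => [<- _|/eqP xv /= vt]; first by rewrite coneU cone_seq_path.
rewrite raddfN /= cone_prepend_gt.
  by rewrite opprK -unconeU IH // ?prependU // (path_sorted st).
by move/allP: (order_path_min lt_trans st); apply.
Qed.

Lemma cone_seq_mem v s : sorted <%O s -> v \in s -> cone v << s >> = 0.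
Proof.
elim: s => [//|x t IH] /= st; rewrite coneU inE /=.
case: ltgtP => [vx /= vt|xv /= vt|//].
  have /allP/(_ _ vt) := order_path_min lt_trans st.
  by rewrite ltNge (ltW vx).
by rewrite -coneU IH ?raddf0 ?oppr0 // (path_sorted st).
Qed.

Lemma uncone_seq_out v s : v \notin s -> uncone v << s >> = 0.
Proof.
elim: s => [_|x t IH] /=; first by rewrite unconeU.
rewrite inE negb_or eq_sym unconeU /= => /andP[/negbTE-> vt].
by rewrite -unconeU IH // raddf0 oppr0.
Qed.

Lemma uncone_cone_seq v s : v \notin s -> uncone v (cone v << s >>) = << s >>.
Proof.
elim: s => [_|x t IH] /=; first by rewrite coneU unconeU /= eqxx.
rewrite inE negb_or coneU /= => /andP[vx vt].
rewrite (negbTE vx); case: ifP => [_|_]; first by rewrite unconeU /= eqxx.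
rewrite raddfN /= uncone_prepend; last by rewrite eq_sym.
by rewrite opprK -coneU IH // prependU.
Qed.

Lemma supported_prepend P (Q : seq gamma -> Prop) x c :
  (forall t, P t -> Q (x :: t)) -> supported P c -> supported Q (prepend x c).
Proof. by move=> PQ; apply: supported_lift => t /PQ Qt; apply: supportedU. Qed.

Lemma supported_bd_seq s :
  supported (fun u => subseq u s /\ (size u).+1 = size s) (bd_seq s).
Proof.
elim: s => [|x t IH] /=; first exact: supported0.
apply: supportedB.
  by apply: supportedU; split=> //; apply: (@subseq_cons _ t).
by apply: supported_prepend IH => u [ut <-] /=; rewrite eqxx.
Qed.

Lemma supported_cone_seq v s : sorted <%O s ->
  supported (fun u => sorted <%O u /\ perm_eq u (v :: s)) (cone_seq v s).
Proof.
elim: s => [|x t IH] /= st; first exact: supportedU.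
case: ltgtP => [vx|xv|_]; last exact: supported0.
  by apply: supportedU; rewrite /= vx.
apply: supportedN; apply: supported_prepend (IH (path_sorted st)) => u [su ut].
split.
  rewrite /= path_sortedE; last exact: lt_trans.
  by rewrite su (perm_all _ ut) /= xv (order_path_min lt_trans st).
rewrite -(perm_cons x) in ut.
by rewrite (perm_trans ut) // (perm_catCA [:: x] [:: v]).
Qed.

Lemma supported_uncone_seq v s : sorted <%O s ->
  supported (fun u => sorted <%O u /\ perm_eq s (v :: u)) (uncone_seq v s).
Proof.
elim: s => [|x t IH] /= st; first exact: supported0.
case: eqP => [<-|_]; first by apply: supportedU; rewrite (path_sorted st).
apply: supportedN; apply: supported_prepend (IH (path_sorted st)) => u [su ut].
split.
  rewrite /= path_sortedE; last exact: lt_trans.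
  move: (order_path_min lt_trans st).
  by rewrite su (perm_all _ ut) /= => /andP[_ ->].
rewrite -(perm_cons x) in ut.
by rewrite (perm_trans ut) // (perm_catCA [:: x] [:: v]).
Qed.

(* [k] counts vertices, so that [chains k.+1 A] is P_k(A). *)
Definition simplex_in k A s : Prop :=
  [/\ sorted <%O s, size s = k & forall x, x \in s -> A x].

Definition chains k A c : Prop := supported (simplex_in k A) c.

Lemma chainsW k A B c : (forall x, A x -> B x) -> chains k A c -> chains k B c.
Proof.
by move=> AB; apply: supportedW => s [ss sk sA]; split=> // x /sA /AB.
Qed.

Lemma chains_dd k A c : chains k.+1 A c -> chains k A (dd c).
Proof.
apply: supported_lift => s [ss sk sA].
apply: (supportedW _ (@supported_bd_seq s)).
move=> u [us]; rewrite sk => -[uk]; split=> //.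
  exact: (subseq_sorted lt_trans us).
by move=> x /(mem_subseq us) /sA.
Qed.

Lemma chains_cone k A v c : A v -> chains k A c -> chains k.+1 A (cone v c).
Proof.
move=> Av; apply: supported_lift => s [ss sk sA].
apply: (supportedW _ (@supported_cone_seq v _ ss)) => u [su us]; split=> //.
  by rewrite (perm_size us) /= sk.
by move=> x; rewrite (perm_mem us) inE => /orP[/eqP->|/sA].
Qed.

Lemma cone_homotopy k A v c : chains k A c -> dd (cone v c) + cone v (dd c) = c.
Proof.
apply: (@supported_ind _ _ (fun c => dd (cone v c) + cone v (dd c) = c)).
- by rewrite !raddf0 addr0.
- by move=> a b Ha Hb; rewrite !raddfB /= addrACA -opprD Ha Hb.
- by move=> s [ss _ _]; apply: cone_homotopy_seq.
Qed.

Lemma cycle_fill k A v c : chains k A c -> dd c = 0 -> dd (cone v c) = c.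
Proof.
by move=> /(cone_homotopy v) E c0; rewrite c0 raddf0 addr0 in E.
Qed.

Lemma dd_fill k A v c : chains k.+1 A c -> dd (cone v (dd c)) = dd c.
Proof. by move=> /chains_dd /cycle_fill; apply; rewrite dd_dd. Qed.

Lemma cycle_exact k A c : chains k.+1 A c -> dd c = 0 ->
  exists2 c', chains k.+2 A c' & dd c' = c.
Proof.
move=> cA dc; have [->|/eqP c0] := pselect (c = 0).
  by exists 0; [apply: supported0 | rewrite raddf0].
have [/= s sc] := supported_neq0 (elimN eqP c0).
have [_ sk sA] := cA s sc.
case: s sk sA {sc} => //= v t _ sA.
exists (cone v c); last exact: cycle_fill cA dc.
by apply: chains_cone => //; apply: sA; rewrite mem_head.
Qed.

End Sequences.

(** * Tail-acyclic families of simplices *)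

Section Acyclic.
Context (disp : Order.disp_t) (gamma : orderType disp).
Local Notation C := {freeg (seq gamma) / int}.
Implicit Types (s t u : seq gamma) (c w : C) (v x y a b : gamma).
Implicit Types (A B D : gamma -> Prop) (S : seq gamma -> Prop).

Definition up A a x : Prop := A x /\ a <= x.
Definition below A a x : Prop := A x /\ x < a.

(** Together with [independent], this makes the boundaries of the m-simplices of [B] in [S] a basis
    of the group of boundaries of m-chains on [B]. *)
Definition spanning S m B : Prop := forall c, chains m.+1 B c ->
  exists c', [/\ chains m.+1 B c', supported S c' & dd c' = dd c].

Definition independent S m B : Prop := forall c, chains m.+1 B c ->
  supported S c -> dd c = 0 -> c = 0.

(* [S] is the set of m-faces of an m-dimensional tail-acyclic complex on [A]. *)
Definition acyclic_on m A : Prop :=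
  exists S, (forall a, spanning S m (up A a)) /\ independent S m A.

Lemma chains_empty k B c : (forall x, ~ B x) -> chains k.+1 B c -> c = 0.
Proof.
move=> B0; apply: supported_eq0 => -[|x s] [//= _ _ sB].
by apply: (B0 x); apply: sB; rewrite mem_head.
Qed.

Lemma spanning_empty S m B : (forall x, ~ B x) -> spanning S m B.
Proof.
move=> B0 c /(chains_empty B0) ->.
by exists 0; split=> //; apply: supported0.
Qed.

Lemma acyclic_on_empty m A : (forall x, ~ A x) -> acyclic_on m A.
Proof.
move=> A0; exists (fun=> True); split=> [a|c /(chains_empty A0)//].
by apply: spanning_empty => x [/A0].
Qed.

(** A boundary is a cycle, and coning it over [b] fills it with simplices through [b]. *)
Lemma cone_spanning m B b : B b -> spanning (fun s => b \in s) m B.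
Proof.
move=> Bb c cB; exists (cone b (dd c)); split; last exact: dd_fill cB.
  by apply: chains_cone => //; apply: chains_dd.
apply: supported_lift (chains_dd cB) => s [ss _ _].
apply: (supportedW _ (@supported_cone_seq _ _ b _ ss)) => u [_ us].
by rewrite (perm_mem us) mem_head.
Qed.

(** A cycle is the boundary of its cone over [b], and coning kills simplices that already contain
    [b]. *)
Lemma cone_independent m B b : independent (fun s => b \in s) m B.
Proof.
move=> c cB bc c0; rewrite -(cone_homotopy b cB) c0 raddf0 addr0.
suff -> : cone b c = 0 by rewrite raddf0.
have sc : supported (fun s => sorted <%O s /\ b \in s) c.
  by move=> s sc; have [ss _ _] := cB s sc; split=> //; apply: bc.
move: {cB bc c0} c sc.
apply: (@supported_ind _ _ (fun c => cone b c = 0)).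
- by rewrite raddf0.
- by move=> c1 c2 E1 E2; rewrite raddfB /= E1 E2 subr0.
- by move=> s [ss bs]; apply: cone_seq_mem.
Qed.

(** The maximum lies in every nonempty tail, so the simplices through it serve all tails at once. *)
Lemma acyclic_on_max m A b : A b -> (forall x, A x -> x <= b) -> acyclic_on m A.
Proof.
move=> Ab bmax; exists (fun s => b \in s); split; last exact: cone_independent.
move=> a; case: (leP a b) => [ab|ba]; first by apply: cone_spanning.
apply: spanning_empty => x [/bmax xb ax].
by have := le_trans ax xb; rewrite leNgt ba.
Qed.

Definition off A v x : Prop := A x /\ x <> v.

Lemma chains_uncone k A v c :
  chains k.+1 A c -> chains k (off A v) (uncone v c).
Proof.
apply: supported_lift => s [ss sk sA].
apply: (supportedW _ (@supported_uncone_seq _ _ v _ ss)) => u [su us].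
have := sorted_uniq lt_trans ltxx ss; rewrite (perm_uniq us) /= => /andP[vu _].
split=> //; first by have := perm_size us; rewrite sk /= => -[].
move=> x xu; split; first by apply: sA; rewrite (perm_mem us) inE xu orbT.
by move=> xv; rewrite -xv xu in vu.
Qed.

Lemma chains_split k A v c :
  chains k A c -> chains k (off A v) (c - cone v (uncone v c)).
Proof.
move: c; apply: (@supported_ind _ _
  (fun c => chains k (off A v) (c - cone v (uncone v c)))).
- by rewrite !raddf0 addr0; apply: supported0.
- move=> c1 c2 H1 H2; rewrite !raddfB /= addrACA -opprD.
  exact: supportedB.
move=> s [ss sk sA]; case vs: (v \in s).
  by rewrite cone_uncone_seq // subrr; apply: supported0.
rewrite uncone_seq_out ?vs // raddf0 subr0; apply: supportedU; split=> // x xs.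
by split; [apply: sA | move=> xv; rewrite xv vs in xs].
Qed.

Lemma uncone_off k A v c : chains k (off A v) c -> uncone v c = 0.
Proof.
apply: (@supported_ind _ _ (fun c => uncone v c = 0)).
- by rewrite raddf0.
- by move=> c1 c2 E1 E2; rewrite raddfB /= E1 E2 subr0.
move=> s [_ _ sA]; apply: uncone_seq_out; apply/negP => /sA[_].
exact.
Qed.

Lemma uncone_cone k A v c : chains k (off A v) c -> uncone v (cone v c) = c.
Proof.
apply: (@supported_ind _ _ (fun c => uncone v (cone v c) = c)).
- by rewrite !raddf0.
- by move=> c1 c2 E1 E2; rewrite !raddfB /= E1 E2.
move=> s [_ _ sA]; apply: uncone_cone_seq; apply/negP => /sA[_].
exact.
Qed.

(** * Inserting the vertices along a well-order *)

Section Insertion.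
Context (prec : gamma -> gamma -> Prop).
Hypothesis (prec_wf : well_founded prec).
Hypothesis (prec_trans : forall y x z, prec x y -> prec y z -> prec x z).
Hypothesis (prec_total : forall x y, [\/ prec x y, x = y | prec y x]).

Lemma prec_max (l : seq gamma) : l <> [::] ->
  exists2 v, v \in l & forall x, x \in l -> x = v \/ prec x v.
Proof.
elim: l => [//|y l IH] _; have [->|l0] := pselect (l = [::]).
  by exists y => [|x]; rewrite ?mem_head // inE => /eqP; left.
have [v vl vmax] := IH l0; have [yv|yv|vy] := prec_total y v.
- exists v; first by rewrite inE vl orbT.
  by move=> x; rewrite inE => /orP[/eqP->|/vmax]; [right|].
- exists v; first by rewrite inE vl orbT.
  by move=> x; rewrite inE yv => /orP[/eqP|/vmax//]; left.
- exists y; first exact: mem_head.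
  move=> x; rewrite inE => /orP[/eqP->|]; first by left.
  by case/vmax=> [->|xv]; right => //; apply: prec_trans xv vy.
Qed.

Lemma max_vertex k B c : chains k.+1 B c -> c <> 0 ->
  exists v, [/\ B v, exists2 s, s \in dom c & v \in s &
    chains k.+1 (fun x => B x /\ (x = v \/ prec x v)) c].
Proof.
move=> cB /supported_neq0[s sc].
have [|v /flattenP[u uc vu] vmax] := @prec_max (flatten (dom c)).
  have [_ sk _] := cB s sc; case: s sk sc => //= x s _ sc l0.
  suff : x \in flatten (dom c) by rewrite l0.
  by apply/flattenP; exists (x :: s) => //; apply: mem_head.
exists v; split; first by have [_ _] := cB u uc; apply.
  by exists u.
move=> t tc; have [st tk tB] := cB t tc; split=> // x xt.
by split; [apply: tB | apply: vmax; apply/flattenP; exists t].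
Qed.

Context (m : nat) (A : gamma -> Prop) (S : gamma -> seq gamma -> Prop).
Let before v x : Prop := A x /\ prec x v.

Hypothesis S_span : forall v a, A v -> a <= v ->
  spanning (S v) m (up (before v) a).
Hypothesis S_indep : forall v, A v -> independent (S v) m (before v).

Let T s : Prop := exists v t, [/\ perm_eq s (v :: t), sorted <%O t, S v t &
  forall x, x \in t -> prec x v].

Lemma prec_irr x : ~ prec x x.
Proof.
by elim/(well_founded_ind prec_wf): x => x IH xx; apply: (IH x).
Qed.

(** With [w] the link of [v] in [c], exchange [w] for a chain [w'] on [S v] with the same boundary.
    The cycle [w - w'] bounds a chain [c1] on earlier vertices, so [c] has the boundary of
    [cone v w' + c1 + c0], and induction handles [c1 + c0]. *)
Lemma insertion_spanning_at a v c :
  chains m.+2 (fun x => up A a x /\ (x = v \/ prec x v)) c ->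
  exists c', [/\ chains m.+2 (up A a) c', supported T c' & dd c' = dd c].
Proof.
elim/(well_founded_ind prec_wf): v c => v IH c cv.
pose B := up (before v) a.
have offB x : off (fun x => up A a x /\ (x = v \/ prec x v)) v x -> B x.
  by case=> -[[Ax ax] [//|xv]] _; split.
have BA x : B x -> up A a x by case=> -[].
pose w := uncone v c; pose c0 := c - cone v w.
have wB : chains m.+1 B w by apply: chainsW offB _; apply: chains_uncone.
have c0B : chains m.+2 B c0 by apply: chainsW offB _; apply: chains_split.
(* The last clause keeps [cone v w'] on the tail: if [v] is outside it, then [w] vanishes and
   [w' = 0] is taken. *)
have [w' [w'B w'S w'w w'v]] : exists w', [/\ chains m.+1 B w',
    supported (S v) w', dd w' = dd w & w' <> 0 -> up A a v].
  have [[Av av]|nv] := pselect (up A a v).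
    by have [w' [? ? ?]] := S_span Av av wB; exists w'.
  suff -> : w = 0.
    by exists 0; split=> //; apply: supported0.
  apply: (@uncone_off m.+2 (up A a) v); apply: chainsW cv => x [xA _].
  by split=> // xv; rewrite xv in xA.
have [|c1 c1B dc1] := cycle_exact (supportedB wB w'B).
  by rewrite raddfB /= w'w subrr.
have [c2 [c2A c2T dc2]] : exists c', [/\ chains m.+2 (up A a) c',
    supported T c' & dd c' = dd (c1 + c0)].
  have cB : chains m.+2 B (c1 + c0) by apply: supportedD.
  have [->|n0] := pselect (c1 + c0 = 0).
    by exists 0; split=> //; apply: supported0.
  have [v' [[[_ v'v] _] _ cv']] := max_vertex cB n0.
  apply: IH v'v _ _; apply: chainsW cv' => x [/BA xA xv'].
  by split.
exists (c2 + cone v w'); split.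
- apply: supportedD => //; have [->|/w'v vA] := pselect (w' = 0).
    by rewrite raddf0; apply: supported0.
  by apply: chains_cone => //; apply: chainsW BA w'B.
- apply: supportedD => //.
  apply: (@supported_lift _ _ (fun t => simplex_in m.+1 B t /\ S v t)).
    move=> t [[st _ tB] St].
    apply: (supportedW _ (@supported_cone_seq _ _ v _ st)) => u [_ ut].
    by exists v, t; split=> // x /tB[[]].
  by move=> t tw; split; [apply: w'B | apply: w'S].
- rewrite raddfD /= dc2 raddfD /= dc1.
  have := cone_homotopy v w'B; have := cone_homotopy v wB.
  rewrite w'w => E1 E2.
  have -> : w - w' = dd (cone v w) - dd (cone v w').
    by rewrite -{1}E1 -{1}E2 opprD addrACA subrr addr0.
  by rewrite /c0 [dd (c - _)]raddfB /= addrAC subrK addrC subrK.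
Qed.

(** At the last-inserted vertex [v] of a nonzero cycle, the link [w] is itself a cycle supported on
    [S v], hence zero, although [v] occurs in the cycle. *)
Lemma insertion_independent : independent T m.+1 A.
Proof.
move=> c cA cT dc; apply: contrapT => n0.
have [v [Av [s sc vs] cv]] := max_vertex cA n0.
pose w := uncone v c; pose c0 := c - cone v w.
have offB x : off (fun x => A x /\ (x = v \/ prec x v)) v x -> before v x.
  by case=> -[Ax [//|xv]] _; split.
have B_off x : before v x -> off (fun=> True) v x.
  by case=> _ xv; split=> // E; rewrite E in xv; apply: prec_irr xv.
have wB : chains m.+1 (before v) w.
  by apply: chainsW offB _; apply: chains_uncone.
have c0B : chains m.+2 (before v) c0.
  by apply: chainsW offB _; apply: chains_split.
have cE : c = cone v w + c0 by rewrite /c0 addrC subrK.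
(* Applying [uncone v] to [cone v (dd w) = w + dd c0] leaves [dd w] on the left and 0 on the right,
   where [v] does not occur. *)
have dw : dd w = 0.
  have E : cone v (dd w) = w + dd c0.
    rewrite -{2}(cone_homotopy v wB) addrAC -raddfD /= -cE dc.
    by rewrite add0r.
  have := uncone_cone (chainsW B_off (chains_dd wB)); rewrite E raddfD /=.
  rewrite (uncone_off (chainsW B_off wB)).
  by rewrite (uncone_off (chainsW B_off (chains_dd c0B))) addr0.
(* A simplex in [T] determines its apex, the vertex inserted last, and hence the face opposite to
   it. *)
have wS : supported (S v) w.
  apply: (@supported_lift _ _ (fun s => s \in dom c)) => // u uc.
  have [su _ uv] := cv u uc; have [v' [t [ut st St tv']]] := cT u uc.
  have v'u : v' \in u by rewrite (perm_mem ut) mem_head.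
  move=> t' t'd; have [st' ut'] := supported_uncone_seq su t'd.
  have vu : v \in u by rewrite (perm_mem ut') mem_head.
  have vv' : v' = v.
    have [_ [//|v'v]] := uv _ v'u.
    move: vu; rewrite (perm_mem ut) inE => /orP[/eqP//|/tv' vv'].
    by case: (prec_irr (prec_trans vv' v'v)).
  suff -> : t' = t by rewrite -vv'.
  apply: (irr_sorted_eq lt_trans ltxx st' st).
  apply: perm_mem; rewrite -(perm_cons v).
  by rewrite vv' in ut; rewrite perm_sym in ut'; apply: perm_trans ut' ut.
have w0 : w = 0 := S_indep Av wB wS dw.
move: c0B; rewrite /c0 w0 raddf0 subr0 => /(_ s sc)[_ _ /(_ v vs)[_]].
exact: prec_irr.
Qed.

Lemma acyclic_on_insertion : acyclic_on m.+1 A.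
Proof.
exists T; split; last exact: insertion_independent.
move=> a c cA; have [->|n0] := pselect (c = 0).
  by exists 0; split=> //; apply: supported0.
by have [v [_ _ cv]] := max_vertex cA n0; apply: insertion_spanning_at cv.
Qed.

End Insertion.

Hypothesis gamma_wf : well_ordered gamma.

(* Insert first the elements of [D] in increasing order, and then the others,
   coning [v] over an element of [D] above [v]. *)
Lemma acyclic_on_cofinal m A D :
  (forall x, D x -> A x) -> (forall x, A x -> exists2 y, D y & x <= y) ->
  (forall d, D d -> acyclic_on m (below D d)) -> acyclic_on m.+1 A.
Proof.
move=> DA Dcof Dac.
pose prec x y := D x /\ ~ D y \/ (D x <-> D y) /\ x < y.
have prec_wf : well_founded prec.
  have accD x : D x -> Acc prec x.
    elim/(well_founded_ind gamma_wf): x => x IH Dx; constructor=> y.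
    by case=> [[//]|[Dyx yx]]; apply: IH => //; apply/Dyx.
  move=> x; elim/(well_founded_ind gamma_wf): x => x IH; constructor=> y.
  by case=> [[/accD//]|[_ /IH]].
have prec_trans y x z : prec x y -> prec y z -> prec x z.
  move=> [[Dx Dy]|[Dxy xy]] [[Dy' Dz]|[Dyz yz]] //.
  - by left; split=> // /Dyz.
  - by left; split=> //; apply/Dxy.
  - by right; split; [rewrite Dxy | apply: lt_trans yz].
have prec_total x y : [\/ prec x y, x = y | prec y x].
  have [Dx|Dx] := pselect (D x); have [Dy|Dy] := pselect (D y).
  - case: (ltgtP x y) => [xy|xy|xy];
      by [constructor 1; right|constructor 3; right|constructor 2].
  - by constructor 1; left.
  - by constructor 3; left.
  - case: (ltgtP x y) => [xy|xy|xy];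
      by [constructor 1; right|constructor 3; right|constructor 2].
have Sex v : exists S, A v ->
    (forall a, a <= v -> spanning S m (up (fun x => A x /\ prec x v) a)) /\
    independent S m (fun x => A x /\ prec x v).
  have [Av|nAv] := pselect (A v); last by exists (fun=> True).
  have [Dv|Dv] := pselect (D v).
    have -> : (fun x => A x /\ prec x v) = below D v.
      apply/funext => x; apply/propext; split.
        by case=> _ [[_ //]|[Dxv xv]]; split=> //; apply/Dxv.
      by case=> Dx xv; split; [apply: DA | right].
    by have [S [S1 S2]] := Dac v Dv; exists S => _; split.
  (* For [v] outside [D], this [r] precedes [v] in [prec] and lies in every tail containing [v]. *)
  have [r Dr vr] := Dcof v Av.
  exists (fun s => r \in s) => _; split; last exact: cone_independent.
  move=> a av; apply: cone_spanning; split; last exact: le_trans vr.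
  by split; [apply: DA | left].
have [S SP] := choice Sex.
apply: (@acyclic_on_insertion prec prec_wf prec_trans prec_total m A S).
  by move=> v a /SP[+ _]; apply.
by move=> v /SP[].
Qed.

End Acyclic.

Lemma fglift_comp (K L : choiceType) (M : lmodType int)
    (f : L -> M) (g : K -> {freeg L / int}) c :
  fglift (fun s => fglift f (g s)) c = fglift f (fglift g c).
Proof.
apply: (@supported_ind _ (fun=> True)
  (fun c => fglift (fun s => fglift f (g s)) c = fglift f (fglift g c))) => //.
- by rewrite !raddf0.
- by move=> a b Ha Hb; rewrite !raddfB /= Ha Hb.
- by move=> s _; rewrite !fgliftU.
Qed.

(** * Splittings of the boundary map *)

Section Splittings.
Context (disp : Order.disp_t) (gamma : orderType disp).
Local Notation C := {freeg (seq gamma) / int}.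
Implicit Types (s : seq gamma) (c w : C) (x y a b : gamma).
Implicit Types (t : seq gamma -> C).
Implicit Types (A B D E : gamma -> Prop).

(* [fglift t] is [sigma \o dd] for a section [sigma] of
   [dd : P_m(A) -> dd P_m(A)] that preserves all tails. *)
Definition is_splitting m A (t : seq gamma -> C) : Prop :=
  [/\ forall a c, chains m.+1 (up A a) c -> chains m.+1 (up A a) (fglift t c),
      forall c, chains m.+1 A c -> dd (fglift t c) = dd c &
      forall c, chains m.+1 A c -> dd c = 0 -> fglift t c = 0].

Definition splits m A : Prop := exists t, is_splitting m A t.

Lemma simplex_in_up k A x s :
  simplex_in k A (x :: s) -> simplex_in k (up A x) (x :: s).
Proof.
case=> ss sk sA; split=> // y ys; split; first exact: sA.
move: ys; rewrite inE => /orP[/eqP->//|ys].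
by apply/ltW; move/allP: (order_path_min lt_trans ss); apply.
Qed.

(** Each simplex lies in the tail at its least vertex, so preserving tails implies preserving the
    chains on [A]. *)
Lemma splitting_chains m A t c :
  is_splitting m A t -> chains m.+1 A c -> chains m.+1 A (fglift t c).
Proof.
case=> tup _ _; apply: supported_lift => -[[]//|x s] /simplex_in_up sx.
rewrite -fgliftU; apply: (@chainsW _ _ _ (up A x)) => [y []//|].
by apply: tup; apply: supportedU.
Qed.

(** All vertices have the same boundary, so the splitting sends them to one nonzero 0-chain. Its
    support lies in the tail at every point of [A], so any vertex in it is the maximum of [A]. *)
Lemma splits0_acyclic A : splits 0 A -> acyclic_on 0 A.
Proof.
case=> t [tup td t0]; have [[x Ax]|nA] := pselect (exists x, A x); last first.
  by apply: acyclic_on_empty => x Ax; apply: nA; exists x.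
have vx y : A y -> chains 1 (up A y) << [:: y] >>.
  by move=> Ay; apply: supportedU; split=> // z; rewrite inE => /eqP->.
have vxA y : A y -> chains 1 A << [:: y] >>.
  by move=> Ay; apply: chainsW (vx y Ay) => z [].
have dv y : dd << [:: y] >> = << [::] >> by rewrite ddU /= raddf0 subr0.
have [|s sc] := @supported_neq0 _ (fglift t << [:: x] >>).
  move=> E; have := td _ (vxA x Ax); rewrite E raddf0 dv => /esym/eqP.
  by rewrite freegU_eq0.
have [ss sk sA] := tup _ _ (vx x Ax) s sc.
case: s sk sc ss sA => [//|y [|//]] _ sc _ sA.
apply: (@acyclic_on_max _ _ 0 A y); first by have [] := sA y (mem_head _ _).
move=> z Az; have E : fglift t << [:: z] >> = fglift t << [:: x] >>.
  apply/eqP; rewrite -subr_eq0 -raddfB /=; apply/eqP/t0.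
    by apply: supportedB; apply: vxA.
  by rewrite raddfB /= !dv subrr.
have := tup _ _ (vx z Az); rewrite E => /(_ _ sc)[_ _ /(_ y (mem_head _ _))].
by case.
Qed.

(** * Retraction of chains onto a cofinal subset *)

Section Carrier.
Context (A D : gamma -> Prop) (r : gamma -> gamma).
Hypothesis DA : forall x, D x -> A x.
Hypothesis rD : forall x, A x -> D (r x) /\ x <= r x.

(* A chain retraction of the simplices in [A] onto those in [D], obtained by
   filling the cycle [carrier k (bd_seq s)] with a cone over a vertex of [D]. *)
Fixpoint carrier k s : C :=
  match k, s with
  | k'.+1, x :: _ => if `[< forall y, y \in s -> D y >] then << s >> else
                     cone (r x) (fglift (carrier k') (bd_seq s))
  | _, _ => << s >>
  end.

Lemma carrier_id k c : chains k D c -> fglift (carrier k) c = c.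
Proof.
apply: (@supported_ind _ _ (fun c => fglift (carrier k) c = c)).
- by rewrite raddf0.
- by move=> a b Ha Hb; rewrite raddfB /= Ha Hb.
move=> s [_ _ sD]; rewrite fgliftU; case: k s sD => [//|k] [//|x s] sD /=.
by rewrite asboolT.
Qed.

Lemma carrier_up k a c :
  chains k (up A a) c -> chains k (up D a) (fglift (carrier k) c).
Proof.
elim: k a c => [|k IH] a c.
  apply: supported_lift => s [ss sk _]; apply: supportedU.
  by case: s sk ss.
apply: supported_lift => -[[]//|x s] sx; have [ss sk sA] := sx.
have [Ax ax] := sA x (mem_head _ _); have [Dr xr] := rD Ax.
rewrite /=; case: asboolP => [sD|_].
  apply: supportedU; split=> // y ys.
  by split; [apply: sD | have [] := sA y ys].
apply: (@chainsW _ _ _ (up D x)).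
  by move=> y [Dy xy]; split=> //; apply: le_trans xy.
apply: chains_cone => //; apply: IH.
rewrite -[_ - _]/(bd_seq (x :: s)) -ddU.
apply: chains_dd; apply: supportedU; apply: simplex_in_up.
by split=> // y /sA[].
Qed.

Lemma dd_chains0 A' c : chains 0 A' c -> dd c = 0.
Proof.
apply: (@supported_ind _ _ (fun c => dd c = 0)).
- by rewrite raddf0.
- by move=> a b Ha Hb; rewrite raddfB /= Ha Hb subr0.
by case=> [|x s] [_ // _ _]; rewrite ddU.
Qed.

(** By induction the carrier of a boundary is a cycle, and coning fills it. *)
Lemma carrier_dd k c : chains k.+1 A c ->
  dd (fglift (carrier k.+1) c) = fglift (carrier k) (dd c).
Proof.
elim: k c => [|k IH]; apply: supported_ind.
1,4: by rewrite !raddf0.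
1,3: by move=> a b Ha Hb; rewrite !raddfB /= Ha Hb.
all: case=> [[]//|x s] sA.
all: have dsx := chains_dd (supportedU (simplex_in_up sA)).
all: rewrite fgliftU [carrier _ _]/=; case: asboolP => [sD|_].
1,3: rewrite carrier_id //; apply: chains_dd; apply: supportedU.
1,2: by have [ss sk _] := sA; split.
all: rewrite -[X in cone _ (fglift _ X)]/(bd_seq (x :: s)) -ddU.
all: apply: (cycle_fill _ (carrier_up dsx)).
  exact: dd_chains0 (carrier_up dsx).
by rewrite IH ?dd_dd ?raddf0 //; apply: chainsW dsx => y [].
Qed.

End Carrier.

(** The splitting is followed by the retraction, which commutes with [dd], fixes chains on [D] and
    preserves tails. *)
Lemma splits_cofinal m A D :
  (forall x, D x -> A x) -> (forall x, A x -> exists2 y, D y & x <= y) ->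
  splits m A -> splits m D.
Proof.
move=> DA Dcof [t tP].
have /choice[r rP] x : exists y, A x -> D y /\ x <= y.
  have [/Dcof[y ? ?]|] := pselect (A x); [by exists y | by exists x].
have DAc k c : chains k D c -> chains k A c by apply: chainsW.
exists (fun s => fglift (carrier D r m.+1) (t s)); have [tup td t0] := tP.
split=> [a c cD|c cD|c cD c0]; rewrite fglift_comp.
- apply: carrier_up rP _ _ _ _; apply: tup; apply: chainsW cD => x [/DA].
  by split.
- rewrite (carrier_dd rP); last by apply: splitting_chains tP (DAc _ _ cD).
  by rewrite td ?carrier_id //; [apply: chains_dd | apply: DAc].
- by rewrite t0 ?raddf0 //; apply: DAc.
Qed.

(** The new splitting [t'] subtracts a boundary, which leaves [dd] unchanged. On a cycle [c = dd w],
    the chains [cone d c] and [w] have the same boundary, hence the same value under [t]. Closure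
    keeps this value below [d], so the subtracted term is [dd w = c]. *)
Lemma splits_below m D t d : is_splitting m.+1 D t -> D d ->
  (forall s, simplex_in m.+2 (below D d) s ->
    chains m.+2 (below D d) (t s)) ->
  splits m (below D d).
Proof.
move=> tP Dd tcl; have [tup td t0] := tP.
(* Truncation to the simplices below [d] need not commute with [dd]; only boundaries of truncated
   chains are used. *)
pose proj : C -> C := fglift (fun s => if all (< d) s then << s >> else 0).
have projup k a c : chains k (up D a) c ->
    chains k (up (below D d) a) (proj c).
  apply: supported_lift => s [ss sk sA].
  case: allP => sd; last exact: supported0.
  apply: supportedU; split=> // x xs; have [Dx ax] := sA x xs.
  by split=> //; split=> //; apply: sd.
have projid k c : chains k (below D d) c -> proj c = c.
  apply: (@supported_ind _ _ (fun c => proj c = c)).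
  - by rewrite /proj raddf0.
  - by move=> a b Ha Hb; rewrite /proj raddfB /= -/proj Ha Hb.
  move=> s [_ _ sA]; rewrite /proj fgliftU ifT //.
  by apply/allP => x /sA[].
pose t' s : C := << s >> - dd (proj (fglift t (cone d << s >>))).
have t'E c : fglift t' c = c - dd (proj (fglift t (cone d c))).
  apply: (@supported_ind _ (fun=> True)
    (fun c => fglift t' c = c - dd (proj (fglift t (cone d c))))) => //.
  - by rewrite /proj !raddf0 addr0.
  - by move=> a b Ha Hb; rewrite /proj !raddfB /= -/proj Ha Hb addrACA -opprD.
  - by move=> s _; rewrite fgliftU.
have belowD k c : chains k (below D d) c -> chains k D c.
  by apply: chainsW => x [].
exists t'; split=> [a c cD|c cD|c cD c0]; rewrite t'E.
- have [ad|da] := leP a d; last first.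
    suff -> : c = 0 by rewrite /proj !raddf0 addr0; apply: supported0.
    apply: chains_empty cD => x [[_ xd] ax].
    by have := lt_trans (le_lt_trans ax xd) da; rewrite ltxx.
  apply: supportedB => //; apply: chains_dd; apply: projup; apply: tup.
  by apply: chains_cone => //; apply: chainsW cD => x [[]].
- by rewrite raddfB /= dd_dd subr0.
have [w wD dw] := cycle_exact cD c0.
have -> : fglift t (cone d c) = fglift t w.
  apply/eqP; rewrite -subr_eq0 -raddfB /=; apply/eqP/t0.
    by apply: supportedB; [apply: chains_cone => //|]; apply: belowD.
  by rewrite raddfB /= dw (cycle_fill d cD c0) subrr.
rewrite (projid m.+2); last exact: supported_lift wD.
by rewrite td ?dw ?subrr //; apply: belowD.
Qed.

End Splittings.

(** * Cofinal subsets *)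

Section Cofinality.
Context (disp : Order.disp_t) (gamma : orderType disp).
Hypothesis gamma_wf : well_ordered gamma.
Implicit Types (s : seq gamma) (x y a b d : gamma).
Implicit Types (A B D E P : gamma -> Prop).

Lemma least_element P : (exists x, P x) ->
  exists x, P x /\ forall y, P y -> x <= y.
Proof.
case=> x; elim/(well_founded_ind gamma_wf): x => x IH Px.
have [[y Py yx]|nP] := pselect (exists2 y, P y & y < x).
  exact: IH yx Py.
exists x; split=> // y Py; rewrite leNgt; apply/negP => yx.
by apply: nP; exists y.
Qed.

Lemma finite_empty_or_max B s : (forall x, B x -> x \in s) ->
  (forall x, ~ B x) \/ exists b, B b /\ forall x, B x -> x <= b.
Proof.
elim: s B => [|y s IH] B Bs; first by left=> x /Bs.
have [By|nBy] := pselect (B y); last first.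
  apply: IH => x Bx; have := Bs x Bx; rewrite inE => /orP[/eqP E|//].
  by rewrite E in Bx.
have [x|n0|[b [[Bb yb] bmax]]] := IH (fun x => B x /\ y < x).
- by case=> Bx yx; have := Bs x Bx; rewrite inE gt_eqF.
- right; exists y; split=> // x Bx; rewrite leNgt.
  by apply/negP => yx; apply: (n0 x).
- right; exists b; split=> // x Bx; have [xy|yx] := leP x y; last exact: bmax.
  exact: le_trans (ltW yb).
Qed.

End Cofinality.

(** * Regular cofinal subsets *)

Section Regularity.
Context (disp : Order.disp_t) (gamma : orderType disp).
Hypothesis gamma_wf : well_ordered gamma.
Implicit Types (s : seq gamma) (x y a b d : gamma).
Implicit Types (A B D E P : gamma -> Prop) (g h : gamma -> gamma).

Definition cofinal_in A D : Prop :=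
  (forall x, D x -> A x) /\ (forall x, A x -> exists2 y, D y & x <= y).

(* [D] has a regular order type: functions from a proper initial segment of [D]
   to [A] are bounded. *)
Definition regular_in A D : Prop :=
  forall d h, D d -> (forall x, A x -> A (h x)) ->
  exists2 b, A b & forall x, below D d x -> h x <= b.

(* If [b] is least such that some [g] is unbounded on the part of [A] below [b],
   then the values at which [g] exceeds all its previous values form such a
   [D]. *)
Lemma regular_cofinal A : exists2 D, cofinal_in A D & regular_in A D.
Proof.
pose bounded b := forall g, (forall x, A x -> A (g x)) ->
  exists2 c, A c & forall x, below A b x -> g x <= c.
have [Abd|] := pselect (forall b, A b -> bounded b).
  exists A; first by split=> // x Ax; exists x.
  by move=> d h Ad; apply: Abd.
move=> /existsNP/(least_element gamma_wf)[b [/not_implyP[Ab]]].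
move=> /existsNP[g /not_implyP[gA gunb]] bmin.
have bd x : A x -> x < b -> bounded x.
  move=> Ax xb; apply: contrapT => nx.
  have : b <= x by apply: bmin; apply/not_implyP.
  by rewrite leNgt xb.
pose D z := exists2 x, below A b x /\ (forall y, below A x y -> g y < g x) &
  z = g x.
exists D; first split.
- by move=> _ [x [[Ax _] _] ->]; apply: gA.
- move=> a Aa.
  (* The first place where [g] reaches [a] is a record of [g]. *)
  have [|x [[Ax xb] xmin]] :=
    @least_element _ _ gamma_wf (fun x => below A b x /\ a <= g x).
    apply: contrapT => nx; apply: gunb; exists a => // x xb.
    rewrite leNgt; apply/negP => ax; apply: nx; exists x; split=> //.
    exact: ltW.
  exists (g x) => //; exists x => //; split=> // y [Ay yx].
  rewrite ltNge; apply/negP => gxy.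
  have : x <= y.
    apply: xmin; split; last exact: le_trans gxy.
    by split=> //; apply: lt_trans yx _; case: Ax.
  by rewrite leNgt yx.
(* Records increase with their position, so those below [g x0] occur before [x0], where minimality
   of [b] bounds [h \o g]. *)
move=> _ h [x0 [[Ax0 x0b] x0max] ->] hA.
have [|c Ac cb] := bd x0 Ax0 x0b (h \o g); first by move=> x /gA /hA.
exists c => // _ [[x [[Ax xb] xmax] ->] gx].
apply: cb; split=> //; rewrite ltNge; apply/negP; rewrite le_eqVlt.
case/orP=> [/eqP E|x0x]; first by rewrite E ltxx in gx.
by have := lt_trans gx (xmax x0 (conj Ax0 x0x)); rewrite ltxx.
Qed.

(** One coordinate at a time: for a fixed first entry [x] induction gives a bound [h x], and
    regularity bounds [h] over the points of [D] below [d]. *)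
Lemma regular_tuples A D d k (F : seq gamma -> gamma) :
  cofinal_in A D -> regular_in A D -> D d -> (forall s, A (F s)) ->
  exists2 b, A b &
    forall s, size s = k -> (forall x, x \in s -> below D d x) -> F s <= b.
Proof.
move=> [DA _] Dreg Dd; elim: k F => [|k IH] F FA.
  by exists (F [::]) => // s /size0nil ->.
have /choice[h hP] x : exists b, A b /\ forall s, size s = k ->
    (forall y, y \in s -> below D d y) -> F (x :: s) <= b.
  by have [b] := IH (fun s => F (x :: s)) (fun s => FA _); exists b.
have [|b Ab hb] := Dreg d h Dd; first by move=> x _; have [] := hP x.
exists b => // -[//|x s] [sk] sD.
apply: le_trans (hb x _); last by apply: sD; rewrite mem_head.
by have [_] := hP x; apply=> // y ys; apply: sD; rewrite inE ys orbT.
Qed.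

Lemma list_bound A a s : A a -> (forall x, x \in s -> A x) ->
  exists2 b, A b & forall x, x \in s -> x <= b.
Proof.
move=> Aa; elim: s => [|y s IH] sA; first by exists a.
have [|b Ab bs] := IH; first by move=> x xs; apply: sA; rewrite inE xs orbT.
have [yb|by_] := leP y b.
  by exists b => // x; rewrite inE => /orP[/eqP->|/bs].
exists y; first by apply: sA; rewrite mem_head.
move=> x; rewrite inE => /orP[/eqP->//|/bs xb].
exact: le_trans (ltW by_).
Qed.

(** The strict running maxima of [u] are cofinal, and one attained at stage [k] exceeds only those
    attained at earlier stages, which are finitely many. *)
Lemma countable_cofinal A (u : nat -> gamma) :
  (forall k, A (u k)) -> (forall a, A a -> exists k, a <= u k) ->
  exists2 D, cofinal_in A D & forall d, D d ->
    (forall x, ~ below D d x) \/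
    exists b, below D d b /\ forall x, below D d x -> x <= b.
Proof.
move=> uA ucof.
pose D x := exists2 k, (forall j, (j < k)%N -> u j < u k) & x = u k.
exists D; first split.
- by move=> _ [k _ ->].
- move=> a Aa; have [k ak kmin] := ex_minnP (ucof a Aa).
  exists (u k) => //; exists k => // j jk.
  apply: lt_le_trans ak; rewrite ltNge; apply/negP => /kmin.
  by rewrite leqNgt jk.
move=> _ [k ku ->]; apply: (@finite_empty_or_max _ _ _ (map u (iota 0 k))).
move=> _ [[j ju ->] jk]; apply: map_f; rewrite mem_iota /= add0n ltnNge.
apply/negP; rewrite leq_eqVlt => /orP[/eqP E|/ju kj].
  by rewrite E ltxx in jk.
by have := lt_trans kj jk; rewrite ltxx.
Qed.

(** * Points closed under the splitting *)

Section Closed.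
Context (A D : gamma -> Prop) (N : nat).
Context (t : seq gamma -> {freeg (seq gamma) / int}).
Hypothesis Dcof : cofinal_in A D.
Hypothesis Dreg : regular_in A D.
Hypothesis Abd : forall u : nat -> gamma, (forall k, A (u k)) ->
  exists2 b, A b & forall k, u k < b.
Hypothesis tD : forall s, simplex_in N.+1 D s -> chains N.+1 D (t s).

Definition closed_at d : Prop := D d /\
  forall s, simplex_in N.+1 (below D d) s -> chains N.+1 (below D d) (t s).

(** One closure step: [F s] bounds the finitely many vertices in [t s], and regularity bounds [F]
    over all tuples below [x]. *)
Lemma next_bound x : A x -> exists y, [/\ D y, x < y &
  forall s, simplex_in N.+1 (below D x) s -> chains N.+1 (below D y) (t s)].
Proof.
move=> Ax; have [DA cofD] := Dcof.
have /choice[F FP] s : exists b, A b /\ (simplex_in N.+1 D s ->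
    chains N.+1 (fun y => D y /\ y <= b) (t s)).
  have [sD|nsD] := pselect (simplex_in N.+1 D s); last by exists x.
  have ts := tD sD.
  have [|b Ab bs] := @list_bound A x (flatten (dom (t s))) Ax.
    by move=> y /flattenP[u uc yu]; have [_ _ /(_ y yu)/DA] := ts u uc.
  exists b; split=> // _ u uc; have [su uk uD] := ts u uc; split=> // y yu.
  by split; [apply: uD | apply: bs; apply/flattenP; exists u].
(* Regularity speaks of initial segments at points of [D], while [x] is only given in [A]. *)
have [d Dd xd] := cofD x Ax.
have [s|b Ab bs] := @regular_tuples A D d N.+1 F Dcof Dreg Dd.
  by have [] := FP s.
(* The sequence [x, b, b, ...] yields one strict bound for both [x] and [b]. *)
have [|c Ac cb] := Abd (u := fun k => if k is 0%N then x else b); first by case.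
have [y Dy cy] := cofD c Ac.
exists y; split=> // [|s [ss sk sD]].
  exact: lt_le_trans (cb 0%N) cy.
have [_ Fs] := FP s; apply: chainsW (Fs _).
  move=> z [Dz zF]; split=> //; apply: le_lt_trans zF _.
  apply: le_lt_trans (bs s sk _) (lt_le_trans (cb 1%N) cy) => w /sD[Dw wx].
  by split=> //; apply: lt_le_trans xd.
by split=> // w /sD[].
Qed.

Lemma common_bound (P : gamma -> Prop) s :
  (exists e, P e) -> (forall y, P y -> exists2 e, P e & y < e) ->
  (forall y, y \in s -> exists2 e, P e & y <= e) ->
  exists2 e, P e & forall y, y \in s -> y < e.
Proof.
move=> [e0 Pe0] Pnext; elim: s => [|y s IH] sP; first by exists e0.
have [|e Pe es] := IH; first by move=> z zs; apply: sP; rewrite inE zs orbT.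
have [e1 Pe1 ye1] := sP y (mem_head _ _).
have [e2 Pe2 ye2] := Pnext e1 Pe1.
have {}ye2 := le_lt_trans ye1 ye2.
have [ee2|e2e] := leP e e2.
  exists e2 => // z; rewrite inE => /orP[/eqP->//|/es ze].
  exact: lt_le_trans ee2.
exists e => // z; rewrite inE => /orP[/eqP->//|/es//].
exact: lt_trans e2e.
Qed.

(** Iterate the closure step from [a] and let [d] be the least point of [D] above all iterates. A
    simplex on the points of [D] below [d] is finite, so it lies below some iterate already, and [t]
    sends it below the next one. *)
Lemma closed_cofinal : cofinal_in A closed_at.
Proof.
have [DA cofD] := Dcof; split=> [x [/DA]//|a Aa].
have /choice[f fP] x : exists y, A x -> [/\ D y, x < y &
    forall s, simplex_in N.+1 (below D x) s -> chains N.+1 (below D y) (t s)].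
  have [/next_bound[y ?]|] := pselect (A x); [by exists y | by exists x].
pose u k := iter k f a.
have uA k : A (u k) by elim: k => //= k /fP[/DA].
have [b Ab ub] := Abd uA; have [y Dy by_] := cofD b Ab.
have [|d [[Dd ud] dmin]] :=
    @least_element _ _ gamma_wf (fun d => D d /\ forall k, u k < d).
  by exists y; split=> // k; apply: lt_le_trans by_.
exists d; last exact: ltW (ud 0%N).
split=> // s [ss sk sd].
have [|||_ [k ->] sek] := @common_bound (fun e => exists k, e = u k) s.
- by exists a, 0%N.
- move=> _ [k ->]; exists (u k.+1); first by exists k.+1.
  by have [] := fP _ (uA k).
- move=> z /sd[Dz zd]; apply: contrapT => nz.
  suff : d <= z by rewrite leNgt zd.
  apply: dmin; split=> // k; rewrite ltNge; apply/negP => zk.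
  by apply: nz; exists (u k) => //; exists k.
have [_ _ /(_ s)] := fP _ (uA k); move=> H; apply: chainsW (H _).
  by move=> z [Dz zu]; split=> //; apply: lt_trans zu (ud k.+1).
by split=> // z zs; split; [have [] := sd z zs | apply: sek].
Qed.

(** Limits of closed points are closed. If the closed points below [d] have no maximum and are
    bounded by a point of [D] below [d], their least strict upper bound [d'] in [D] is closed and
    below [d], hence below itself. *)
Lemma closed_below d : closed_at d ->
  [\/ forall x, ~ below closed_at d x,
      exists b, below closed_at d b /\ forall x, below closed_at d x -> x <= b |
      cofinal_in (below D d) (below closed_at d)].
Proof.
move=> dcl; have [[b bmax]|nmax] := pselect (exists b,
    below closed_at d b /\ forall x, below closed_at d x -> x <= b).
  by constructor 2; exists b.
have [[e0 e0d]|nE] := pselect (exists e, below closed_at d e); last first.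
  by constructor 1 => x xd; apply: nE; exists x.
constructor 3; split=> [x [[Dx _] xd]//|x [Dx xd]].
apply: contrapT => nx.
have Ex e : below closed_at d e -> e < x.
  by move=> ed; rewrite ltNge; apply/negP => xe; apply: nx; exists e.
have [|d' [[Dd' Ed'] d'min]] := @least_element _ _ gamma_wf
    (fun d' => D d' /\ forall e, below closed_at d e -> e < d').
  by exists x.
have d'd : d' < d by apply: le_lt_trans xd; apply: d'min.
suff d'cl : closed_at d' by have := Ed' d' (conj d'cl d'd); rewrite ltxx.
split=> // s [ss sk sd'].
have [|||e ed se] := @common_bound (below closed_at d) s.
- by exists e0.
- move=> y yd; apply: contrapT => ny; apply: nmax; exists y; split=> // z zd.
  by rewrite leNgt; apply/negP => yz; apply: ny; exists z.
- move=> y /sd'[Dy yd']; apply: contrapT => ny.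
  suff : d' <= y by rewrite leNgt yd'.
  apply: d'min; split=> // e ed; rewrite ltNge; apply/negP => ye.
  by apply: ny; exists e.
have [[_ ecl] _] := ed; apply: chainsW (ecl s _).
  by move=> z [Dz ze]; split=> //; apply: lt_trans ze (Ed' e ed).
by split=> // z zs; split; [have [] := sd' z zs | apply: se].
Qed.

End Closed.

Theorem splits_acyclic m A : splits m A -> acyclic_on m A.
Proof.
elim: m A => [|m IH] A Asp; first exact: splits0_acyclic.
have [[u [uA ucof]]|nu] := pselect (exists u : nat -> gamma,
    (forall k, A (u k)) /\ forall a, A a -> exists k, a <= u k).
  have [D [DA Dcof] Dbelow] := countable_cofinal uA ucof.
  apply: (acyclic_on_cofinal gamma_wf DA Dcof) => d /Dbelow[n0|[b [bd bmax]]].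
    exact: acyclic_on_empty.
  exact: acyclic_on_max bmax.
(* Without a cofinal sequence, every sequence is strictly bounded; constant sequences show that [A]
   has no maximum either. *)
have Abd (u : nat -> gamma) : (forall k, A (u k)) ->
    exists2 b, A b & forall k, u k < b.
  move=> uA; apply: contrapT => nb; apply: nu; exists u; split=> // a Aa.
  apply: contrapT => na; apply: nb; exists a => // k; rewrite ltNge.
  by apply/negP => ak; apply: na; exists k.
have [D Dcof Dreg] := regular_cofinal A; have [DA cofD] := Dcof.
have [t tP] := splits_cofinal DA cofD Asp.
have tD s : simplex_in m.+2 D s -> chains m.+2 D (t s).
  move=> sD; rewrite -fgliftU; apply: splitting_chains tP _.
  exact: supportedU.
have [EA Ecof] := closed_cofinal Dcof Dreg Abd tD.
apply: (acyclic_on_cofinal gamma_wf EA Ecof) => d dcl.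
have [n0|[b [bd bmax]]|[E1 E2]] := closed_below dcl.
- exact: acyclic_on_empty.
- exact: acyclic_on_max bmax.
(* Closure at [d] lowers the degree of the splitting on [below D d], and cofinality carries it to
   the closed points below [d], where induction applies. *)
have [Dd tcl] := dcl.
by apply: IH; apply: splits_cofinal E1 E2 _; apply: splits_below tP Dd tcl.
Qed.

End Regularity.

(** * Simplices as sorted sequences *)

Section Translation.
Context (disp : Order.disp_t) (gamma : orderType disp).
Local Notation C := {freeg (seq gamma) / int}.
Implicit Types (s u : seq gamma) (a x : gamma).

Definition simplex_of m s : option (simplex gamma m) :=
  obind (fun u : m.-tuple gamma => insub u) (insub s).

Lemma simplex_ofK m (sx : simplex gamma m) :
  simplex_of m (tval (val sx)) = Some sx.
Proof. by rewrite /simplex_of valK /= valK. Qed.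

Lemma simplex_of_sorted m s : sorted <%O s -> size s = m ->
  exists2 sx, simplex_of m s = Some sx & tval (val sx) = s.
Proof.
move=> ss sm; pose u := @Tuple m _ s (introT eqP sm).
pose sx : simplex gamma m :=
  exist (fun u : m.-tuple gamma => sorted <%O u) u ss.
by exists sx => //; rewrite -[s]/(tval (val sx)) simplex_ofK.
Qed.

Definition toseq m : chain gamma m -> C :=
  fglift (fun sx : simplex gamma m => << tval (val sx) >> : C).

HB.instance Definition _ m := GRing.isZmodMorphism.Build
  (chain gamma m) C (@toseq m) (lift_is_additive _).

Definition ofseq m : C -> chain gamma m :=
  fglift (fun s => if simplex_of m s is Some sx then << sx >> else 0).

HB.instance Definition _ m := GRing.isZmodMorphism.Build
  C (chain gamma m) (@ofseq m) (lift_is_additive _).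

Lemma toseqU m (sx : simplex gamma m) : toseq << sx >> = << tval (val sx) >>.
Proof. exact: fgliftU. Qed.

Lemma toseqK m : cancel (@toseq m) (@ofseq m).
Proof.
move=> c; apply: (@supported_ind _ (fun=> True)
  (fun c => ofseq m (toseq c) = c)) => //.
- by rewrite !raddf0.
- by move=> a b Ha Hb; rewrite !raddfB /= Ha Hb.
- by move=> sx _; rewrite toseqU /ofseq fgliftU simplex_ofK.
Qed.

Lemma ofseqK m A c : chains m A c -> toseq (ofseq m c) = c.
Proof.
apply: (@supported_ind _ _ (fun c => toseq (ofseq m c) = c)).
- by rewrite !raddf0.
- by move=> a b Ha Hb; rewrite !raddfB /= Ha Hb.
move=> s [ss sm _]; have [sx E sxs] := simplex_of_sorted ss sm.
by rewrite /ofseq fgliftU E toseqU sxs.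
Qed.

Lemma bd_seqE s : bd_seq s =
  \sum_(i < size s) << (-1) ^+ i *g (take i s ++ drop i.+1 s) >>.
Proof.
elim: s => [|x s IH] /=; first by rewrite big_ord0.
rewrite big_ord_recl /= drop0 expr0 IH raddf_sum -sumrN /=; congr (_ + _).
apply: eq_bigr => i _; rewrite exprS mulN1r -freegUN; congr (- _).
rewrite /prepend liftU; apply/eqP/freeg_eqP => y.
by rewrite coeffZ !coeffU mul1r.
Qed.

Lemma val_del m (sx : simplex gamma m.+1) i :
  tval (val (del sx i)) = take i (val sx) ++ drop i.+1 (val sx).
Proof.
have x0 : gamma := tnth (val sx) ord0.
have im := ltn_ord i; rewrite ltnS in im.
have sz : size (take i (val sx)) = i by rewrite size_takel // size_tuple leqW.
apply: (@eq_from_nth _ x0).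
  by rewrite size_tuple size_cat sz size_drop size_tuple subSS subnKC.
move=> j; rewrite size_tuple => jm.
rewrite -[j]/(val (Ordinal jm)) -tnth_nth tnth_map tnth_ord_tuple.
rewrite (tnth_nth x0) nth_cat sz /= /bump.
case: ltnP => ji; first by rewrite nth_take // add0n.
by rewrite nth_drop add1n addSn subnKC.
Qed.

Lemma toseq_bd m (c : chain gamma m.+1) : toseq (bd c) = dd (toseq c).
Proof.
apply: (@supported_ind _ (fun=> True)
  (fun c => toseq (bd c) = dd (toseq c))) => //.
- by rewrite !raddf0.
- by move=> a b Ha Hb; rewrite !raddfB /= Ha Hb.
move=> sx _; rewrite toseqU ddU /bd fgliftU raddf_sum bd_seqE size_tuple.
apply: eq_bigr => i _; rewrite /= /toseq liftU val_del.
by apply/eqP/freeg_eqP => y; rewrite coeffZ !coeffU mul1r.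
Qed.

Lemma bd_bd m (c : chain gamma m.+2) : bd (bd c) = 0.
Proof. by apply: (can_inj (@toseqK m)); rewrite !toseq_bd dd_dd raddf0. Qed.

Lemma bd_ofseq m A c : chains m.+1 A c -> bd (ofseq m.+1 c) = ofseq m (dd c).
Proof.
move=> cA; apply: (can_inj (@toseqK m)).
by rewrite toseq_bd !(@ofseqK _ A) //; apply: chains_dd.
Qed.

Lemma supported_toseq m (P : simplex gamma m -> Prop)
    (Q : seq gamma -> Prop) c :
  (forall sx, P sx -> Q (tval (val sx))) -> supported P c ->
  supported Q (toseq c).
Proof. by move=> PQ; apply: supported_lift => sx /PQ Qs; apply: supportedU. Qed.

Lemma supported_ofseq m (P : simplex gamma m -> Prop)
    (Q : seq gamma -> Prop) c :
  (forall sx, Q (tval (val sx)) -> P sx) -> supported Q c ->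
  supported P (ofseq m c).
Proof.
move=> PQ; apply: supported_lift => s.
case E: (simplex_of m s) => [sx|] Qs; last exact: supported0.
suff sxs : tval (val sx) = s by apply: supportedU; apply: PQ; rewrite sxs.
move: E; rewrite /simplex_of; case: insubP => //= u _ <-.
by case: insubP => // sx' _ <- [<-].
Qed.

Lemma chains_toseq m (c : chain gamma m) (A : gamma -> Prop) :
  supported (fun sx => forall x, x \in tval (val sx) -> A x) c ->
  chains m A (toseq c).
Proof.
apply: supported_toseq => sx sA; split=> //; first exact: (valP sx).
exact: size_tuple.
Qed.

Lemma chains_ofseq m (A : gamma -> Prop) c : chains m A c ->
  supported (fun sx => forall x, x \in tval (val sx) -> A x) (ofseq m c).
Proof. by apply: supported_ofseq => sx []. Qed.

Lemma supported_bd m (P : gamma -> Prop) (c : chain gamma m.+1) :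
  supported (fun sx => forall x, x \in tval (val sx) -> P x) c ->
  supported (fun sx => forall x, x \in tval (val sx) -> P x) (bd c).
Proof.
move=> cP; rewrite -[bd c]toseqK toseq_bd.
by apply: chains_ofseq; apply: chains_dd; apply: chains_toseq.
Qed.

Definition vmin m (sx : simplex gamma m.+1) : gamma := tnth (val sx) ord0.

Lemma mem_vmin m (sx : simplex gamma m.+1) : vmin sx \in tval (val sx).
Proof. exact: mem_tnth. Qed.

Lemma vmin_le m (sx : simplex gamma m.+1) x :
  x \in tval (val sx) -> vmin sx <= x.
Proof.
rewrite /vmin (tnth_nth x); case: sx => -[[//|y s] ?] /= ss.
rewrite inE => /orP[/eqP->//|xs].
by apply/ltW; move/allP: (order_path_min lt_trans ss); apply.
Qed.

End Translation.

(** * Free systems of boundaries *)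

Section FreeSystem.
Context (disp : Order.disp_t) (gamma : orderType disp) (n : nat).
Local Notation point := {b : gamma & term (dP gamma n) b}.
Local Notation C := {freeg point / int}.

(** As the bonding maps are inclusions, a formal sum of elements of the system has a value in
    P_(n-1)(gamma), independent of the term in which it is computed. *)
Definition ev : C -> chain gamma n :=
  fglift (fun p : point => val (tagged p : dP_term n (tag p))).

HB.instance Definition _ := GRing.isZmodMorphism.Build C (chain gamma n) ev
  (lift_is_additive _).

Lemma evU p : ev << p >> = val (tagged p : dP_term n (tag p)).
Proof. exact: fgliftU. Qed.

Definition forget a : {freeg (above (dP gamma n) a) / int} -> C :=
  fglift (fun q => << val q >> : C).

HB.instance Definition _ a := GRing.isZmodMorphism.Build _ C (@forget a)
  (lift_is_additive _).

Definition unforget a : C -> {freeg (above (dP gamma n) a) / int} :=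
  fglift (fun p => if insub p is Some q then << q >> else 0).

HB.instance Definition _ a := GRing.isZmodMorphism.Build C _ (@unforget a)
  (lift_is_additive _).

Lemma forgetK a : cancel (@forget a) (@unforget a).
Proof.
move=> c; apply: (@supported_ind _ (fun=> True)
  (fun c => unforget a (forget c) = c)) => //.
- by rewrite !raddf0.
- by move=> c1 c2 H1 H2; rewrite !raddfB /= H1 H2.
- by move=> sx _; rewrite /forget fgliftU /unforget fgliftU valK.
Qed.

Lemma unforgetK a (F : C) : supported (fun p => a <= tag p) F ->
  forget (unforget a F) = F.
Proof.
apply: (@supported_ind _ _ (fun F => forget (unforget a F) = F)).
- by rewrite !raddf0.
- by move=> c1 c2 H1 H2; rewrite !raddfB /= H1 H2.
move=> p ap; rewrite /unforget fgliftU; case: insubP => [q _ <-|].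
  by rewrite /forget fgliftU.
by rewrite ap.
Qed.

Lemma ev_forget a f :
  ev (forget f) = val (\sum_(p <- dom f) bond_above p *~ coeff p f
    : dP_term n a).
Proof.
rewrite raddf_sum /= -{1}[f]freeg_sumE !raddf_sum /=; apply: eq_bigr => p _.
rewrite -[X in << X *g _ >>]intz -freegU_mulz !raddfMz /= /forget fgliftU evU.
exact/esym/(raddfMz (val : dP_term n a -> chain gamma n)).
Qed.

Lemma decompositionE (B : forall b, term (dP gamma n) b -> Prop) a
    (x : term (dP gamma n) a) f :
  decomposition B x f <->
  supported (fun p => B (tag p) (tagged p) /\ a <= tag p) (forget f) /\
  ev (forget f) = val (x : dP_term n a).
Proof.
split=> [[fB ->]|[fB fx]].
  rewrite -ev_forget; split=> //; apply: supported_lift fB => q qB.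
  by apply: supportedU; split=> //; apply: (valP q).
split; last by apply: val_inj; rewrite -[RHS]ev_forget fx.
rewrite -[f]forgetK; apply: supported_lift fB => p [pB ap].
case: insubP => [q _ E|_]; last exact: supported0.
by apply: supportedU; rewrite E.
Qed.

(** Formal sums over all points live in one group, whereas [above a] changes with [a];
    decompositions at different terms can then be compared. *)
Lemma free_systemP : free_system (dP gamma n) <->
  exists B : point -> Prop, forall a z, z \in dP_pred (n := n) a ->
    exists! F : C, supported (fun p => B p /\ a <= tag p) F /\ ev F = z.
Proof.
split=> [[B BP]|[B BP]].
  exists (fun p => B (tag p) (tagged p)) => a z za.
  have [f [/decompositionE[fB fz] funiq]] :=
    BP a (exist _ z za : dP_term n a).
  exists (forget f); split=> // F [FB Fz].
  have aF : forget (unforget a F) = F.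
    by apply: unforgetK; apply: supportedW FB => p [].
  by rewrite -aF; congr forget; apply: funiq; apply/decompositionE; rewrite aF.
exists (fun b x => B (Tagged (term (dP gamma n)) x)) => a x.
have [F [[FB Fx] Funiq]] := BP a (val (x : dP_term n a)) (valP _).
have aF : forget (unforget a F) = F.
  by apply: unforgetK; apply: supportedW FB => p [].
have tagE (p : point) : Tagged (term (dP gamma n)) (tagged p) = p by case: p.
exists (unforget a F); split.
  apply/decompositionE; rewrite aF; split=> //.
  by apply: supportedW FB => p; rewrite tagE.
move=> f /decompositionE[fB fx].
rewrite -[f]forgetK; congr unforget; apply: Funiq; split=> //.
by apply: supportedW fB => p; rewrite tagE.
Qed.

End FreeSystem.

(** * Splittings, complexes and free systems *)

Section Equivalences.
Context (disp : Order.disp_t) (gamma : orderType disp) (n : nat).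
Hypothesis gamma_wf : well_ordered gamma.
Local Notation point := {b : gamma & term (dP gamma n) b}.
Implicit Types (a b x : gamma) (s u : seq gamma).

Lemma chain_onE m a (c : chain gamma m) : chain_on (tail a) c <->
  supported (fun sx => forall x, x \in tval (val sx) -> a <= x) c.
Proof. by []. Qed.

Lemma bottom x0 : exists a, forall x, a <= x.
Proof.
have [|a [_ amin]] := @least_element _ _ gamma_wf (fun=> True).
  by exists x0.
by exists a => x; apply: amin.
Qed.

(** The tail at the least vertex of a simplex lies in every tail containing the simplex, so it
    suffices to control [tau] there. *)
Lemma splits_of_simplices (tau : simplex gamma n.+1 -> chain gamma n.+1) :
  (forall sx, chain_on (tail (vmin sx)) (tau sx)) ->
  (forall sx, bd (tau sx) = bd << sx >>) ->
  (forall c, bd c = 0 -> fglift tau c = 0) ->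
  splits n (fun _ : gamma => True).
Proof.
move=> tail_tau bd_tau tau0.
pose t s := toseq (fglift tau (ofseq n.+1 << s >>)).
have tE c : fglift t c = toseq (fglift tau (ofseq n.+1 c)).
  apply: (@supported_ind _ (fun=> True)
    (fun c => fglift t c = toseq (fglift tau (ofseq n.+1 c)))) => //.
  - by rewrite !raddf0.
  - by move=> c1 c2 H1 H2; rewrite !raddfB /= H1 H2.
  - by move=> s _; rewrite fgliftU.
have bdE c : bd (fglift tau c) = bd c.
  apply: (@supported_ind _ (fun=> True)
    (fun c => bd (fglift tau c) = bd c)) => //.
  - by rewrite !raddf0.
  - by move=> c1 c2 H1 H2; rewrite !raddfB /= H1 H2.
  - by move=> sx _; rewrite fgliftU bd_tau.
exists t; split=> [a c cA|c cA|c cA c0]; rewrite tE.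
- apply: chains_toseq; apply: supported_lift (chains_ofseq cA) => sx sA.
  move=> sy /tail_tau ty x /ty ax; split=> //.
  by apply: le_trans ax; have [_] := sA _ (mem_vmin sx).
- by rewrite -toseq_bd bdE toseq_bd (ofseqK cA).
- by rewrite tau0 ?raddf0 // (bd_ofseq cA) c0 raddf0.
Qed.

(** Decompose the boundary of each simplex in the tail at its least vertex, then lift each basis
    element to a chain on its own tail. A cycle receives a decomposition of 0, which is empty by
    uniqueness at the least element of [gamma]. *)
Lemma free_splits :
  free_system (dP gamma n) -> splits n (fun _ : gamma => True).
Proof.
move=> /free_systemP[B BP].
have /choice[lf lfP] (p : point) : exists c : chain gamma n.+1,
    chain_on (tail (tag p)) c /\ bd c = ev << p >>.
  case: p => b [z zb]; have /asboolP[c cb zE] := zb.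
  by exists c; split=> //; rewrite evU /= zE.
have /choice[F FP] (sx : simplex gamma n.+1) : exists F : {freeg point / int},
    supported (fun p => B p /\ vmin sx <= tag p) F /\ ev F = bd << sx >>.
  have [|F [FP _]] := BP (vmin sx) (bd << sx >>); last by exists F.
  apply/asboolP; exists << sx >> => //; apply/chain_onE; apply: supportedU.
  exact: vmin_le.
have bd_lf G : bd (fglift lf G) = ev G.
  apply: (@supported_ind _ (fun=> True)
    (fun G => bd (fglift lf G) = ev G)) => //.
  - by rewrite !raddf0.
  - by move=> c1 c2 H1 H2; rewrite !raddfB /= H1 H2.
  - by move=> p _; rewrite fgliftU; have [] := lfP p.
apply: (@splits_of_simplices (fun sx => fglift lf (F sx))) => [sx|sx|c c0].
- have [FB _] := FP sx; apply/chain_onE; apply: supported_lift FB => p [_ sp].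
  have [lfp _] := lfP p; move=> sy syd x xs.
  exact: le_trans sp (lfp sy syd x xs).
- by rewrite bd_lf; have [] := FP sx.
have [->|/supported_neq0[sx _]] := pselect (c = 0); first by rewrite raddf0.
have [a amin] := bottom (vmin sx).
rewrite fglift_comp; suff -> : fglift F c = 0 by rewrite raddf0.
have [|G [_ Guniq]] := BP a 0.
  by apply/asboolP; exists 0; [apply: supported0 | rewrite raddf0].
rewrite -[LHS]Guniq; first apply: Guniq.
  by split; [apply: supported0 | rewrite raddf0].
split.
  apply: (@supported_lift _ _ (fun=> True)) => // sy _.
  by have [FB _] := FP sy; apply: supportedW FB => p [].
rewrite -c0; apply: (@supported_ind _ (fun=> True)
    (fun c => ev (fglift F c) = bd c)) => //.
- by rewrite !raddf0.
- by move=> c1 c2 H1 H2; rewrite !raddfB /= H1 H2.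
- by move=> sy _; rewrite fgliftU; have [] := FP sy.
Qed.

Lemma sort_fset s : sorted <%O s -> sort <=%O [fset x in s]%fset = s.
Proof.
move=> ss; apply: (le_sorted_eq (sort_le_sorted _)).
  by apply: sub_sorted ss => x y; apply: ltW.
rewrite perm_sort; apply: uniq_perm; first exact: fset_uniq.
  exact: sorted_uniq lt_trans ltxx _ ss.
by move=> x; rewrite !inE.
Qed.

Lemma card_fset_sorted s : sorted <%O s -> #|` [fset x in s]%fset| = size s.
Proof. by move=> /sort_fset/(congr1 size); rewrite size_sort. Qed.

Lemma vertices_sort m (sx : simplex gamma m) :
  sort <=%O (vertices sx) = tval (val sx).
Proof. exact: sort_fset (valP sx). Qed.

Lemma card_vertices m (sx : simplex gamma m) : #|` vertices sx| = m.
Proof. by rewrite card_fset_sorted ?size_tuple //; apply: (valP sx). Qed.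

Lemma acyclic_complex : (0 < n)%N -> acyclic_on n (fun _ : gamma => True) ->
  exists G : {fset gamma} -> Prop,
    [/\ simplicial_complex G, n_dimensional G n & tail_acyclic G n].
Proof.
move=> n0 [S [Sspan Sind]].
(* The full skeleton in dimensions below [n], with [S] supplying the n-faces. *)
pose G (f : {fset gamma}) := f != fset0 /\
  ((#|` f| <= n)%N \/ #|` f| = n.+1 /\ S (sort <=%O f)).
have Gsmall m (sx : simplex gamma m.+1) : (m < n)%N -> G (vertices sx).
  move=> mn; split; first by rewrite -cardfs_gt0 card_vertices.
  by left; rewrite card_vertices.
have Gtop (sx : simplex gamma n.+1) : S (tval (val sx)) -> G (vertices sx).
  move=> Ss; split; first by rewrite -cardfs_gt0 card_vertices.
  by right; rewrite card_vertices vertices_sort.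
have sub a m (sx : simplex gamma m) :
    (forall x, x \in tval (val sx) -> up (fun=> True) a x) ->
    {subset vertices sx <= tail a}.
  by move=> sA x; rewrite !inE => /sA[].
exists G; split.
- split=> [s []//|s t [_ Gs] ts t0]; split=> //.
  have [tn|nt] := leqP #|` t| n; [by left | right].
  case: Gs => [sn|[sn Ss]].
    by have := leq_trans (fsubset_leq_card ts) sn; rewrite leqNgt nt.
  have -> : t = s.
    by apply/eqP; rewrite eqEfcard ts sn.
  by [].
- split=> [k s [[_ Gs] sk]|[f fn]].
    by case: Gs; rewrite sk; [apply: ltnW | case=> -[->]].
  have ss : sorted <%O (sort <=%O f).
    rewrite lt_sorted_uniq_le sort_uniq fset_uniq /=.
    exact: sort_le_sorted.
  have szs : size (sort <=%O f) = n.+1 by rewrite size_sort.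
  move: (sort _ _) ss szs => s ss szs.
  case: s ss szs => [//|x s] ss szs.
  have sA : chains n.+1 (up (fun=> True) x) << x :: s >>.
    by apply: supportedU; apply: simplex_in_up; split.
  have [c [cA cS dc]] := Sspan x _ sA.
  (* If [c] were 0, the simplex [x :: s] would be a cycle, hence the boundary of its cone over its
     own vertex [x], which is 0. *)
  have [|u uc] := @supported_neq0 _ c.
    move=> c0; have := cone_homotopy x sA; rewrite -dc c0 !raddf0 addr0.
    rewrite cone_seq_mem ?mem_head // raddf0 => /esym/eqP.
    by rewrite freegU_eq0.
  have [su uk _] := cA u uc.
  exists [fset y in u]%fset; split; last by rewrite card_fset_sorted.
  split; first by rewrite -cardfs_gt0 card_fset_sorted ?uk.
  by right; rewrite card_fset_sorted // sort_fset //; split=> //; apply: cS.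
split=> [s|a k z zG z0].
  rewrite /face prednK //; split=> [[]//|sn]; split=> //.
  by split; [rewrite -cardfs_gt0 sn | left; rewrite sn].
have zA : chains k.+1 (up (fun=> True) a) (toseq z).
  apply: chains_toseq; apply: supportedW zG => sx [_ st] x xs.
  by split=> //; apply: st; rewrite !inE.
have dz : dd (toseq z) = 0 by rewrite -toseq_bd z0 raddf0.
have cA : chains k.+2 (up (fun=> True) a) (cone a (toseq z)).
  exact: chains_cone.
have dc : dd (cone a (toseq z)) = toseq z by apply: cycle_fill zA dz.
(* Below degree [n - 1] the cone over [a] has all its simplices in the skeleton. From degree [n] on,
   independence and dimension leave only the zero cycle. In degree [n - 1] the cone is replaced by a
   chain on [S] with the same boundary. *)
have [kn|kn|kn] := ltngtP k.+1 n.
- exists (ofseq k.+2 (cone a (toseq z))).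
    apply: supportedW (chains_ofseq cA) => sx sA.
    by split; [apply: Gsmall | apply: sub].
  by rewrite (bd_ofseq cA) dc toseqK.
- suff -> : z = 0.
    by exists 0; [apply: supported0 | rewrite raddf0].
  rewrite -[z]toseqK; suff -> : toseq z = 0 by rewrite raddf0.
  move: kn; rewrite ltnS leq_eqVlt => /orP[/eqP kn|kn].
    subst k; apply: Sind dz; first by apply: chainsW zA.
    apply: supported_toseq zG => sx [[_ Gs] _].
    rewrite card_vertices ltnn vertices_sort in Gs.
    by case: Gs => // -[].
  suff -> : z = 0 by rewrite raddf0.
  apply: supported_eq0 zG => sx [[_ Gs] _].
  rewrite card_vertices in Gs; case: Gs => [|[[E _]]].
    by rewrite leqNgt ltnS ltnW.
  by rewrite E ltnn in kn.
- subst n; have [c [cA' cS dc']] := Sspan a _ cA.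
  exists (ofseq k.+2 c).
    have cAS :
        supported (fun s => simplex_in k.+2 (up (fun=> True) a) s /\ S s) c.
      by move=> s sc; split; [apply: cA' | apply: cS].
    apply: supported_ofseq cAS => sx [[_ _ sA] Ss].
    by split; [apply: Gtop | apply: sub].
  by rewrite (bd_ofseq cA') dc' dc toseqK.
Qed.

(** Acyclicity in degree [n], with no faces one dimension higher, makes the boundaries of the
    n-faces independent; acyclicity of the tails in degree [n - 1] makes them span at every term. *)
Lemma complex_free (G : {fset gamma} -> Prop) : (0 < n)%N ->
  n_dimensional G n -> tail_acyclic G n -> free_system (dP gamma n).
Proof.
move=> n0 [Gn _] [Gfull Gac].
have Ginj (c : chain gamma n.+1) : chain_in G c -> bd c = 0 -> c = 0.
  move=> cG c0; have [//|/supported_neq0[sx _]] := pselect (c = 0).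
  have [a amin] := bottom (vmin sx).
  have [|c2 c2G <-] := Gac a n c _ c0.
    by move=> sy /cG Gy; split=> // x _; apply: amin.
  suff -> : c2 = 0 by rewrite raddf0.
  apply: supported_eq0 c2G => sy [Gy _].
  by have := Gn n.+1 _ (conj Gy (card_vertices sy)); rewrite ltnn.
have Gspan a z : z \in dP_pred (n := n) a -> exists2 c : chain gamma n.+1,
    chain_in (restrict G (tail a)) c & bd c = z.
  (* Since [n] is positive, [z] is a cycle in degree [k = n - 1 >= 0], and [G] contains all
     simplices of that dimension. *)
  case: (n) n0 Gfull Gac z => // k _ Gfull' Gac' z /asboolP[c cA zE].
  apply: Gac'; last by rewrite zE bd_bd.
  rewrite zE; apply: supportedW (supported_bd cA) => sx sA; split.
    by have [_ H] := Gfull' (vertices sx); have [] := H (card_vertices sx).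
  by move=> x; rewrite inE => /sA.
have vminP (sx : simplex gamma n.+1) :
    bd << sx >> \in dP_pred (n := n) (vmin sx).
  apply/asboolP; exists << sx >> => //; apply/chain_onE; apply: supportedU.
  exact: vmin_le.
pose pt (sx : simplex gamma n.+1) : point := Tagged (term (dP gamma n))
  (exist _ (bd << sx >>) (vminP sx) : dP_term n (vmin sx)).
pose ptc : chain gamma n.+1 -> {freeg point / int} :=
  fglift (fun sx => << pt sx >>).
have ev_ptc c : ev (ptc c) = bd c.
  apply: (@supported_ind _ (fun=> True) (fun c => ev (ptc c) = bd c)) => //.
  - by rewrite /ptc !raddf0.
  - by move=> c1 c2 H1 H2; rewrite /ptc !raddfB /= -/ptc H1 H2.
  - by move=> sx _; rewrite /ptc fgliftU evU.
pose B (p : point) := exists2 sx, G (vertices sx) & p = pt sx.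
apply/free_systemP; exists B => a z za.
have uniq0 F : supported B F -> ev F = 0 -> F = 0.
  move=> FB F0.
  (* Turning points of [B] back into n-faces writes [F] as [ptc] of a chain in [G], to which [Ginj]
     applies. *)
  have /choice[g gP] (p : point) : exists c : chain gamma n.+1,
      B p -> chain_in G c /\ ptc c = << p >>.
    have [[sx Gs ->]|] := pselect (B p); last by exists 0.
    exists << sx >> => _; split; first exact: supportedU.
    by rewrite /ptc fgliftU.
  have FE : ptc (fglift g F) = F.
    move: {F0} F FB; apply: supported_ind.
    - by rewrite /ptc !raddf0.
    - by move=> c1 c2 H1 H2; rewrite /ptc !raddfB /= -/ptc H1 H2.
    - by move=> p /gP[_]; rewrite fgliftU.
  rewrite -FE (Ginj (fglift g F)) ?/ptc ?raddf0 //.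
    by apply: supported_lift FB => p /gP[].
  by rewrite -ev_ptc FE.
have [c cG cz] := Gspan a z za.
exists (ptc c); split=> [|F [FB Fz]].
  split; last by rewrite ev_ptc.
  apply: supported_lift cG => sx [Gs sa]; apply: supportedU; split.
    by exists sx.
  by apply: sa; rewrite inE mem_vmin.
apply/eqP; rewrite -subr_eq0; apply/eqP/uniq0.
  apply: supportedB; last by apply: supportedW FB => p [].
  by apply: supported_lift cG => sx [Gs _]; apply: supportedU; exists sx.
by rewrite raddfB /= ev_ptc cz Fz subrr.
Qed.

End Equivalences.

Theorem theorem3p7 (n : nat) (disp : Order.disp_t) (gamma : orderType disp)
    (hn : (1 <= n)%N) (hgamma : well_ordered gamma) :
  free_system (dP gamma n) <->
  exists G : {fset gamma} -> Prop,
    [/\ simplicial_complex G, n_dimensional G n & tail_acyclic G n].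
Proof.
split=> [/(free_splits hgamma)/(splits_acyclic hgamma)|[G [_ Gdim Gac]]].
  exact: acyclic_complex.
exact: complex_free Gdim Gac.
Qed.
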